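(* Let $A$ be a primitive $N\times N$-matrix with entries in $\{0,1\}$, let $G_A$ be its Deaconu--Renault groupoid with the measure $\mu_{G_A}$ described in the context, and let $D=(2P_A-1)(\Delta+M_\ell)$ be the operator on $L^2(G_A,\mu_{G_A})$ described in the context. The Hilbert space $L^2(G_A,\mu_{G_A})$ admits an orthonormal basis $$(\mathrm{e}_{\gamma},\mathrm{e}_{(\gamma,\nu,j)})_{(\gamma,\nu,j)\in\mathfrak{I}_A}\subset C_c^\infty(G_A)\subset L^2(G_A,\mu_{G_A})$$ of eigenfunctions for the operator $D$ (here $\mathrm e_\gamma$ is indexed by $\gamma\in I_A$, and the functions are those described in the context). The eigenvalues are given by $$D\mathrm{e}_\gamma=\mathrm{sgn}(\gamma)|\gamma|\,\mathrm{e}_\gamma,\qquad D\mathrm{e}_{(\gamma,\nu,j)}=-\bigl(|\gamma|+\lambda^A_{s(\gamma)}(\nu)\bigr)\mathrm{e}_{(\gamma,\nu,j)},$$ where $\mathrm{sgn}:I_A\to\{\pm1\}$ is given by $\mathrm{sgn}(\gamma)=1$ if $|s(\gamma)|=1$ and $\mathrm{sgn}(\gamma)=-1$ if $|s(\gamma)|>1$. The numbers $\lambda^A_{s(\gamma)}(\nu)$ are eigenvalues of the logarithmic Dirichlet Laplacian $\Delta$ on $G_A$ and are explicitly given by $$\lambda^A_{s(\gamma)}(\nu)=1+\lambda_{\max}v_{\nu_1}\sum_{k=0}^{|\nu|-|s(\gamma)|-1}u_{\nu_{|\nu|-k-1}}\bigl(1-P_{\nu_{|\nu|-k-1},\nu_{|\nu|-k}}\bigr),$$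 where $u$ and $v$ are the Perron--Frobenius eigenvectors of $A$ and its transpose $A^T$, respectively, and $P_{i,j}=\frac{A_{i,j}u_j}{\lambda_{\max}u_i}$ is the transition probability of going from vertex $i$ to vertex $j$ in the finite directed graph associated to $A$.
   Context: **Markov chain.** $A\in M_N(\{0,1\})$ is primitive: some power of $A$ has all entries positive. $V_A$ is the set of admissible finite words $\alpha=\alpha_1\cdots\alpha_n$ in $\{1,\dots,N\}$ ($A_{\alpha_i,\alpha_{i+1}}=1$), including the empty word $\emptyset$; $|\alpha|=n$ is the length. $\Sigma_A=\{x\in\{1,\dots,N\}^{\mathbb N}:A_{x_n,x_{n+1}}=1\ \forall n\}$, $\sigma_A$ is the left shift, and $C(\alpha)$ is the cylinder set of infinite admissible words starting with $\alpha$ ($C(\emptyset)=\Sigma_A$). Fix $\lambda>1$ and let $\mathrm d(x,y)=\lambda^{-\inf\{n-1:x_n\ne y_n\}}$. $\lambda_{\max}>1$ is the Perron--Frobenius eigenvalue of $A$; $u,v$ are positive Perron--Frobenius eigenvectors of $A$ and $A^T$ with $\sum_iu_iv_i=1$. The Parry measure $\mu$ on $\Sigma_A$ satisfies $\mu(C(\alpha))=v_{\alpha_1}u_{\alpha_n}\lambda_{\max}^{-(n-1)}$ for admissible $\alpha$ of length $n\ge1$. Put $\delta=\log_\lambda(\lambda_{\max})$. **Groupoid.** $G_A=\{(x,n,y)\in\Sigma_A\times\mathbb Z\times\Sigma_A:\exists k\ge0,\ n+k\ge0,\ \sigma_A^{n+k}(x)=\sigma_A^k(y)\}$, with $s(x,n,y)=y$,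 $r(x,n,y)=x$, $c(x,n,y)=n$, $\kappa(x,n,y)=\min\{k\ge\max\{0,-n\}:\sigma_A^{n+k}(x)=\sigma_A^k(y)\}$, and the coarsest topology making $s,r,\kappa,c$ continuous. To $g=(x,n,y)$ one associates the words $\ell_r(g)$ of length $n+\kappa(g)$ and $\ell_s(g)$ of length $\kappa(g)+1$ with $x=\ell_r(g)\sigma_A^{\kappa(g)}(y)$, $y=\ell_s(g)\sigma_A^{\kappa(g)+1}(y)$. The index set is $$I_A=\{\gamma=\alpha.\beta\in V_A\times(V_A\setminus\{\emptyset\}):\ \alpha=\emptyset\ \text{or}\ A_{\alpha_{|\alpha|},\beta_{|\beta|}}=1\}.$$ For $\gamma=\alpha.\beta\in I_A$ write $r(\gamma)=\alpha$, $s(\gamma)=\beta$, $|\gamma|=|\alpha|+|\beta|$, and let $G_\gamma\subseteq G_A$ be the clopen set of $g$ with $\ell_r(g)=\alpha$, $\ell_s(g)=\beta$. Then $G_A=\bigsqcup_{\gamma\in I_A}G_\gamma$, and $s$ restricts to a homeomorphism $s_\gamma:G_\gamma\to C(s(\gamma))$. Let $\mathrm d_\gamma,\mu_\gamma$ be the pull-backs of $\mathrm d,\mu$ along $s_\gamma$, let $\mu_{G_A}$ be the measure restricting to $\mu_\gamma$ on each $G_\gamma$, and let $\mathrm d_{G_A}$ be the extended metric equal to $\mathrm d_\gamma$ on each $G_\gamma$ and $\infty$ between different $G_\gamma$'s. $C_c^\infty(G_A)$ denotes the compactly supported locally constant functions. **Operators.** The logarithmic Dirichlet Laplacian $\Delta$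 is the positive self-adjoint operator which is the closure of $$\Delta f(g_1)=\int_{G_A}\frac{f(g_1)-f(g_2)}{\mathrm d_{G_A}(g_1,g_2)^\delta}\,\mathrm d\mu_{G_A}(g_2),\quad f\in C_c^\infty(G_A)$$ (with $\infty^{-\delta}=0$). $M_\ell$ is multiplication by $\ell:G_A\to\mathbb N$, $\ell|_{G_\gamma}=|\gamma|$. $P_A$ is the orthogonal projection onto $F_A$, the closed span of the characteristic functions $\chi_{G_\gamma}$ with $|s(\gamma)|=1$. $D=(2P_A-1)(\Delta+M_\ell)$, i.e. $D=M_\ell$ on $F_A$ and $D=-(\Delta+M_\ell)$ on $F_A^\perp$. **Basis.** For $\beta\in V_A\setminus\{\emptyset\}$ decompose $L^2(C(\beta),\mu)=\bigoplus_{k\ge0}L^2_k(C(\beta),\mu)$ orthogonally so that $\bigoplus_{k=0}^nL^2_k$ is the span of $\{\chi_{C(\beta\nu)}:|\nu|=n\}$. Put $h_\beta=\mu(C(\beta))^{-1/2}\chi_{C(\beta)}$. For $k>0$ let $H_k(\beta)$ be an orthonormal basis of $L_k^2(C(\beta),\mu)$ such that each $h\in H_k(\beta)$ is supported in a cylinder $C(\omega_\beta(h))$ for a unique word $\omega_\beta(h)\in V_A$ starting with $\beta$ of length $|\beta|+k-1$, and $h$ is constant on $C(\eta)$ for all $|\eta|\ge|\beta|+k$. Enumerate $\bigsqcup_{k>0}H_k(\beta)$ as $(h_{\nu,j})$ with $\nu=\beta\nu_0\in V_A$ and $j\in J_\beta(\nu)$, where $\omega_\beta(h_{\nu,j})=\nu$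 and $J_\beta(\nu)\subseteq\{1,\dots,N\}$ is a non-empty index set with $\#J_\beta(\nu)=\#\{i:A_{\nu_{|\nu|},i}=1\}-1\ge1$. Let $\mathfrak I_A$ be the set of $(\gamma,\nu,j)\in I_A\times(V_A\setminus\{\emptyset\})\times\{1,\dots,N\}$ with $\nu=s(\gamma)\nu_0$ and $j\in J_{s(\gamma)}(\nu)$, and put $$\mathrm e_\gamma=\chi_{G_\gamma}\cdot(h_{s(\gamma)}\circ s),\qquad \mathrm e_{(\gamma,\nu,j)}=\chi_{G_\gamma}\cdot(h_{\nu,j}\circ s).$$
   Formalization: The leading term 1 in the formula for λ^A_{s(γ)}(ν) is corrected to λ_max v_{ν_1} u_{ν_|ν|} (1 fails for the golden mean shift), and I_A is restricted to those γ with G_γ non-empty, since otherwise e_γ = 0. *)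

(* Defs.v *)
From HB Require Import structures.
From mathcomp Require Import all_boot all_order all_algebra.
From mathcomp Require Import all_classical all_reals all_analysis.
From mathcomp Require Import complex.
Import numFieldNormedType.Exports.
Import Order.TTheory GRing.Theory Num.Theory.

Set Implicit Arguments.
Unset Strict Implicit.
Unset Printing Implicit Defensive.

Local Open Scope classical_set_scope.
Local Open Scope ring_scope.
Local Open Scope complex_scope.

Notation borel T := (g_sigma_algebraType (@open T)).

(** Elements of L2 are represented by square-integrable functions; operators are
represented by their graphs, which are stable under a.e. equality. *)
Section L2.
Context {d : measure_display} {T : measurableType d} {R : realType}.
Variable mu : {measure set T -> \bar R}.
Implicit Types (f g : T -> R[i]).

Definition cintegral f : R[i] :=
  (\int[mu]_(x in setT) complex.Re (f x)) +i*
  (\int[mu]_(x in setT) complex.Im (f x)).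

Definition cdot f g : R[i] := cintegral (fun x => f x * (g x)^*).

Definition normsq f : \bar R :=
  (\int[mu]_x ((complex.Re (f x) ^+ 2 + complex.Im (f x) ^+ 2)%:E))%E.

Definition L2 : set (T -> R[i]) := [set f |
  [/\ measurable_fun setT (fun x => complex.Re (f x)),
      measurable_fun setT (fun x => complex.Im (f x)) &
      (normsq f < +oo)%E]].

Definition span (S : set (T -> R[i])) : set (T -> R[i]) := [set f |
  exists (n : nat) (c : 'I_n -> R[i]) (e : 'I_n -> T -> R[i]),
    (forall i, S (e i)) /\ forall x, f x = \sum_(i < n) c i * e i x].

Definition closed_span (S : set (T -> R[i])) : set (T -> R[i]) := [set f |
  L2 f /\ forall eps : R, 0 < eps ->
    exists2 g, span S g & (normsq (fun x => (f x - g x)%R) < eps%:E)%E].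

Definition orth_proj (V : set (T -> R[i])) f p :=
  V p /\ forall g, V g -> cdot (fun x => f x - p x) g = 0.

Definition orthonormal {I : eqType} (D : set I) (e : I -> T -> R[i]) :=
  forall i j, D i -> D j -> cdot (e i) (e j) = (i == j)%:R.

Definition orthonormal_basis {I : eqType} (D : set I) (e : I -> T -> R[i]) :=
  [/\ forall i, D i -> L2 (e i), orthonormal D e &
      L2 `<=` closed_span (e @` D)].

Definition op_closure (dom : set (T -> R[i]))
    (L : (T -> R[i]) -> T -> R[i]) f g :=
  [/\ L2 f, L2 g &
    exists fn : nat -> T -> R[i],
      [/\ forall n, dom (fn n),
          normsq (fun x => fn n x - f x) @[n --> \oo] --> 0%E &
          normsq (fun x => L (fn n) x - g x) @[n --> \oo] --> 0%E]].

Definition op_eigenvalue (L : (T -> R[i]) -> (T -> R[i]) -> Prop) (a : R[i]) :=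
  exists f, [/\ L2 f, ~ {ae mu, forall x, f x = 0} &
                L f (fun x => a * f x)].

End L2.

Definition Ccinfty {R : realType} (T : topologicalType) : set (T -> R[i]) :=
  [set f : T -> R[i] | (forall x : T, \forall y \near x, f y = f x) /\
           compact (closure [set x : T | f x != 0])].

(** An N x N zero-one matrix, N >= 1, is a boolean matrix ['M[bool]_N.+1]. *)
Section Words.
Variables (N : nat) (A : 'M[bool]_N.+1).

Definition mx01 (R : pzRingType) : 'M[R]_N.+1 := \matrix_(i, j) (A i j)%:R.

Definition primitive :=
  exists2 k : nat, (0 < k)%N & forall i j, 0 < (mx01 int ^+ k) i j.

Definition word := seq 'I_N.+1.

Definition admissible (w : word) : bool := sorted (fun i j => A i j) w.

(** The [n]-th letter, counted from 1 *)
Definition letter (w : word) (n : nat) : 'I_N.+1 := nth ord0 w n.-1.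

(** The last clause expresses the minimality of kappa: if the last letter of
[r(gamma)] were the last but one letter of [s(gamma)], then [G_gamma] would be
empty.  With it, the source map is a bijection from [G_gamma] to
[C(s(gamma))] for every [gamma] in the index set. *)
Definition IA : set (word * word) := [set gam |
  let alp := gam.1 in let bet := gam.2 in
  [/\ admissible alp, admissible bet, bet != [::],
      alp = [::] \/ A (letter alp (size alp)) (letter bet (size bet)) &
      [\/ alp = [::], size bet = 1%N |
          letter alp (size alp) != letter bet (size bet).-1]]].

Lemma primitive_succ : primitive -> forall i, exists j, A i j.
Proof.
move=> [[//|k] _ Ak] i; apply: contrapT => /forallNP nA.
have := Ak i i; rewrite exprS mxE big1 ?ltxx // => j _.
by rewrite mxE; case: (A i j) (nA j) => [[]|_] //; rewrite mul0r.
Qed.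

End Words.

Section PathSpace.
Variables (N : nat) (A : 'M[bool]_N.+1).

Definition path_set :
    set (prod_topology (fun _ : nat => discrete_topology 'I_N.+1)) :=
  [set x | forall n, A (x n) (x n.+1)].

(** Sigma_A with the product topology; the sequence [x_1 x_2 ...] is
represented by the function [n |-> x_(n+1)]. *)
Definition path_space (_ : primitive A) : Type := set_type path_set.

Variable hA : primitive A.
Local Notation X := (path_space hA).

Definition some_path : X.
Proof.
pose f i := xchoose (primitive_succ hA i).
apply: (exist _ (fun n => iter n f ord0)).
by apply/mem_set => n /=; exact: xchooseP (primitive_succ hA _).
Defined.

HB.instance Definition _ :=
  Topological.copy X (set_type path_set).
HB.instance Definition _ := isPointed.Build X some_path.

Definition coord (x : X) (n : nat) : 'I_N.+1 := sval x n.

Lemma shift_subproof (x : X) : (fun n => coord x n.+1) \in path_set.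
Proof. by apply/mem_set => n; exact: (set_mem (svalP x)). Qed.

Definition shift (x : X) : X :=
  exist _ (fun n => coord x n.+1) (shift_subproof x).

Definition initial_word (x : X) (n : nat) : word N := mkseq (coord x) n.

Definition cyl (w : word N) : set X :=
  [set x | initial_word x (size w) = w].

Definition path_dist {R : realType} (lam : R) (x y : X) : R :=
  if pselect (exists n, coord x n != coord y n) is left h
  then lam ^- ex_minn h else 0.

Definition lag (x : X) (n : int) (y : X) (k : nat) : Prop :=
  0 <= n + k%:Z /\ iter (absz (n + k%:Z)) shift x = iter k shift y.

Definition groupoid : Type :=
  set_type [set g : X * int * X |
              exists k, lag g.1.1 g.1.2 g.2 k].

HB.instance Definition _ := Choice.on groupoid.

Definition rng (g : groupoid) : X := (sval g).1.1.
Definition coc (g : groupoid) : int := (sval g).1.2.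
Definition src (g : groupoid) : X := (sval g).2.

Lemma lag_ex (g : groupoid) : exists k, `[< lag (rng g) (coc g) (src g) k >].
Proof. by have [k gk] := set_mem (svalP g); exists k; apply/asboolP. Qed.

Definition kappa (g : groupoid) : nat := ex_minn (lag_ex g).

Definition groupoid_coords (g : groupoid) :
    X * X * nat * discrete_topology int :=
  (src g, rng g, kappa g, coc g).

Definition some_arrow : groupoid.
Proof.
apply: (exist _ (some_path, 0, some_path)).
by apply/mem_set; exists 0%N.
Defined.

HB.instance Definition _ :=
  Topological.copy groupoid (initial_topology groupoid_coords).
HB.instance Definition _ := isPointed.Build groupoid some_arrow.

Definition ell_r (g : groupoid) : word N :=
  initial_word (rng g) (absz (coc g + (kappa g)%:Z)).
Definition ell_s (g : groupoid) : word N := initial_word (src g) (kappa g).+1.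

Definition Gpart (gam : word N * word N) : set groupoid :=
  [set g | ell_r g = gam.1 /\ ell_s g = gam.2].

Definition gam_size (gam : word N * word N) : nat :=
  (size gam.1 + size gam.2)%N.

Definition ell (g : groupoid) : nat := gam_size (ell_r g, ell_s g).

Definition groupoid_dist {R : realType} (lam : R) (g1 g2 : groupoid) : \bar R :=
  if (ell_r g1 == ell_r g2) && (ell_s g1 == ell_s g2)
  then (path_dist lam (src g1) (src g2))%:E else +oo%E.

End PathSpace.

Section Measures.
Context {R : realType} {N : nat} (A : 'M[bool]_N.+1) (hA : primitive A).
Variables (lmax : R) (u v : 'cV[R]_N.+1).

(** An eigenvalue equal to the spectral radius *)
Definition PF_eigenvalue : Prop :=
  eigenvalue (mx01 A R) lmax /\
  forall z : R[i], eigenvalue (mx01 A R[i]) z -> `|z| <= lmax%:C.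

Definition PF_eigenvectors : Prop :=
  [/\ forall i, 0 < u i 0 /\ 0 < v i 0,
      mx01 A R *m u = lmax *: u,
      (mx01 A R)^T *m v = lmax *: v &
      \sum_i u i 0 * v i 0 = 1].

Definition trans_prob (i j : 'I_N.+1) : R :=
  (A i j)%:R * u j 0 / (lmax * u i 0).

Definition parry_measure
    (mu : {measure set (borel (path_space hA)) -> \bar R}) : Prop :=
  forall w : word N, admissible A w -> w != [::] ->
    mu (cyl w) =
      (v (letter w 1) 0 * u (letter w (size w)) 0 * lmax ^- (size w).-1)%:E.

(** The leading term is [lmax ^ |nu| * mu (C(nu))], coming from the integral
over [C(nu)], which for a function [h] constant on the cylinders [C(nu i)] and
with zero mean on [C(nu)] equals [lmax ^ |nu| * mu (C(nu)) * h].  It is 1 for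
the full shift ([lmax = N], [u_i = 1], [v_i = 1 / N]) but not in general: for
the matrix with rows (1 1) and (1 0) and [nu = 1], it is [(5 + 3 sqrt 5) / 10]. *)
Definition lambdaA (bet nu : word N) : R :=
  lmax * v (letter nu 1) 0 * u (letter nu (size nu)) 0 +
  lmax * v (letter nu 1) 0 *
  \sum_(k < size nu - size bet)
    u (letter nu (size nu - k - 1)) 0 *
    (1 - trans_prob (letter nu (size nu - k - 1)) (letter nu (size nu - k))).

Definition groupoid_measure
    (mu : {measure set (borel (path_space hA)) -> \bar R})
    (muG : {measure set (borel (groupoid hA)) -> \bar R}) : Prop :=
  forall gam, IA A gam ->
  forall B : set (borel (groupoid hA)), measurable B -> B `<=` Gpart gam ->
    muG B = mu (@src _ _ hA @` B).

End Measures.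

Section LevelBasis.
Context {R : realType} {N : nat} {A : 'M[bool]_N.+1} {hA : primitive A}.
Variable mu : {measure set (borel (path_space hA)) -> \bar R}.

Definition cyl_span (bet : word N) (n : nat) : set (path_space hA -> R[i]) :=
  span (T := borel (path_space hA))
    [set f | exists2 w : word N, size w = n & f = \1_(cyl (bet ++ w))].

(** L2_k(C(beta)): the orthogonal complement in [cyl_span bet k] of the
preceding spans *)
Definition level (bet : word N) (k : nat) : set (path_space hA -> R[i]) :=
  [set f | cyl_span bet k f /\
    forall n g, (n < k)%N -> cyl_span bet n g -> cdot mu f g = 0].

Variables (J : word N -> word N -> {set 'I_N.+1})
          (h : word N -> word N -> 'I_N.+1 -> path_space hA -> R[i]).

Definition level_index (bet : word N) (k : nat) : set (word N * 'I_N.+1) :=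
  [set p | [/\ prefix bet p.1, admissible A p.1,
               size p.1 = (size bet + k - 1)%N & p.2 \in J bet p.1]].

(** [h bet nu j] is h_(nu, j) in H_k(bet), k = |nu| - |bet| + 1. *)
Definition level_basis : Prop :=
  forall bet, admissible A bet -> bet != [::] ->
  [/\ forall nu, prefix bet nu -> admissible A nu ->
        #|J bet nu| = (#|[set i | A (letter nu (size nu)) i]%SET| - 1)%N,
      forall k, (0 < k)%N ->
        [/\ forall p, level_index bet k p -> level bet k (h bet p.1 p.2),
            orthonormal mu (level_index bet k) (fun p => h bet p.1 p.2) &
            level bet k `<=` span (T := borel (path_space hA))
              [set h bet p.1 p.2 | p in level_index bet k]] &
      forall k p, (0 < k)%N -> level_index bet k p ->
        (forall x, ~ cyl p.1 x -> h bet p.1 p.2 x = 0) /\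
        (forall eta : word N, (size bet + k <= size eta)%N ->
           forall x y, cyl eta x -> cyl eta y ->
             h bet p.1 p.2 x = h bet p.1 p.2 y)].

Definition hnorm (bet : word N) (x : path_space hA) : R[i] :=
  ((Num.sqrt (fine (mu (cyl bet))))^-1)%:C * \1_(cyl bet) x.

(** e_gamma is indexed by [inl gamma], e_(gamma, nu, j) by [inr (gamma, nu, j)] *)
Definition basis_index : Type :=
  ((word N * word N) + (word N * word N) * word N * 'I_N.+1)%type.

Definition frakIA : set ((word N * word N) * word N * 'I_N.+1) :=
  [set t | [/\ IA A t.1.1, admissible A t.1.2, prefix t.1.1.2 t.1.2 &
               t.2 \in J t.1.1.2 t.1.2]].

Definition basis_domain : set basis_index :=
  [set i | match i with inl gam => IA A gam | inr t => frakIA t end].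

Definition basis_fun (i : basis_index) (g : groupoid hA) : R[i] :=
  match i with
  | inl gam => \1_(Gpart gam) g * hnorm gam.2 (src g)
  | inr (gam, nu, j) => \1_(Gpart gam) g * h gam.2 nu j (src g)
  end.

End LevelBasis.

Arguments level_index {N} A J bet k _.
Arguments frakIA {N} A J _.
Arguments basis_domain {N} A J _.

Section Operators.
Context {R : realType} {N : nat} {A : 'M[bool]_N.+1} {hA : primitive A}.
Variable muG : {measure set (borel (groupoid hA)) -> \bar R}.
Variables lam lmax : R.
Implicit Types f : groupoid hA -> R[i].

Definition delta : R := ln lmax / ln lam.

(** The diagonal, where the value is 0, is a null set for each [g1]. *)
Definition kernel (g1 g2 : groupoid hA) : R :=
  match groupoid_dist lam g1 g2 with
  | r%:E => (r `^ delta)^-1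
  | _ => 0
  end.

Definition Laplacian0 f (g1 : groupoid hA) : R[i] :=
  cintegral muG (fun g2 => (f g1 - f g2) * (kernel g1 g2)%:C).

Definition Laplacian f (g : groupoid hA -> R[i]) : Prop :=
  op_closure muG (@Ccinfty R (groupoid hA)) Laplacian0 f g.

Definition FA : set (groupoid hA -> R[i]) :=
  closed_span muG [set f | exists gam : word N * word N,
    [/\ IA A gam, size gam.2 = 1%N & f = \1_(Gpart gam)]].

(** The domain is the intersection of the domains of Delta and M_ell. *)
Definition Dirac f (g : groupoid hA -> R[i]) : Prop :=
  exists f1 p : groupoid hA -> R[i],
  let f2 := fun x => f1 x + (ell x)%:R * f x in
  [/\ Laplacian f f1,
      L2 muG (fun x => (ell x)%:R * f x),
      orth_proj muG FA f2 p,
      L2 muG g &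
      {ae muG, forall x, g x = p x *+ 2 - f2 x}].

Definition sgn_gam (gam : word N * word N) : R[i] :=
  if size gam.2 == 1%N then 1 else -1.

End Operators.

(* Main.v *)
(** On each [G_gamma] the source map identifies L2 with [L2(C(beta), mu)].  For
[x] in [C(nu)], the integrand [(h x - h y) / d(x, y)^delta] is, as a function
of [y], a finite combination of the shells [C(x_1...x_m) \ C(x_1...x_{m+1})],
[|beta| <= m < |nu|], on which [d(x, y)^-delta] equals [lmax^m], plus
[lmax^|nu| (h x 1_{C(nu)} - h)]; since [h] has mean zero, integrating against
the Parry measure gives [lambdaA beta nu * h x].  For [x] outside [C(nu)] the
distance to [x] is constant on [C(nu)] and the mean zero property gives 0.
The eigenfunctions lie in [C_c^infty], so constant sequences suffice in the
closure of the Laplacian, and they belong either to [F_A] or to its orthogonal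
complement.  Completeness: the indicator of every set [G_gamma /\ s^-1 C(w)]
is a finite combination of basis functions; these sets form a pi-system
generating the Borel sets, and the Borel sets of finite measure have L2-total
indicators. *)

Require Import Defs.
From HB Require Import structures.
From mathcomp Require Import all_boot all_order all_algebra.
From mathcomp Require Import all_classical all_reals all_analysis.
From mathcomp Require Import measurable_realfun.
From mathcomp Require Import complex.
From mathcomp Require Import ring lra zify.
Import numFieldNormedType.Exports.
Import Order.TTheory GRing.Theory Num.Theory.

Local Open Scope classical_set_scope.
Local Open Scope ring_scope.
Local Open Scope complex_scope.

Set Implicit Arguments.
Unset Strict Implicit.
Unset Printing Implicit Defensive.

Local Notation span := Defs.span.
Local Notation coord := Defs.coord.
Local Notation shift := Defs.shift.
Local Notation kernel := Defs.kernel.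
Local Notation orthonormal := Defs.orthonormal.

(** * Square-integrable complex functions *)

(** [muG] is prescribed only on Borel subsets of a single part of the groupoid, so no change of
    variables for general functions is set up. The functions integrated along a part are lifts of
    functions of finitely many letters, that is, finite combinations of indicators of the sets
    [Zpart gam w]; integrability, integrals and inner products then reduce to the numbers
    [mu (cyl w)]. The integrand of the Laplacian fits this pattern although its kernel is unbounded:
    [h] depends on only one letter beyond [nu], so [h x - h y] vanishes once points of C(nu) agree
    on |nu| + 1 letters, before the kernel exceeds lmax^|nu|. A second constraint is that the
    approximation arguments need finite measure: the Dynkin induction is therefore run inside one
    part, and only its results are assembled over the countably many parts. Inner products pass to
    limits by AM-GM with a small weight instead of Cauchy-Schwarz. *)

Section ComplexParts.
Context {R : rcfType}.
Implicit Types z w : R[i].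
Local Notation Re := (@complex.Re R).
Local Notation Im := (@complex.Im R).

Lemma ReD z w : Re (z + w) = Re z + Re w. Proof. by case: z; case: w. Qed.
Lemma ImD z w : Im (z + w) = Im z + Im w. Proof. by case: z; case: w. Qed.
Lemma ReN z : Re (- z) = - Re z. Proof. by case: z. Qed.
Lemma ImN z : Im (- z) = - Im z. Proof. by case: z. Qed.
Lemma ReM z w : Re (z * w) = Re z * Re w - Im z * Im w.
Proof. by case: z; case: w. Qed.
Lemma ImM z w : Im (z * w) = Re z * Im w + Im z * Re w.
Proof. by case: z; case: w. Qed.
Lemma Reconj z : Re z^* = Re z. Proof. by case: z. Qed.
Lemma Imconj z : Im z^* = - Im z. Proof. by case: z. Qed.
Lemma Re_nat n : Re n%:R = n%:R.
Proof. by elim: n => // n IH; rewrite -addn1 !natrD ReD IH. Qed.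
Lemma Im_nat n : Im n%:R = 0.
Proof. by elim: n => // n IH; rewrite -addn1 natrD ImD IH addr0. Qed.
Lemma complexP z w : Re z = Re w -> Im z = Im w -> z = w.
Proof. by case: z => a b; case: w => c d /= -> ->. Qed.

Definition sqn z : R := Re z ^+ 2 + Im z ^+ 2.
Lemma sqn_ge0 z : 0 <= sqn z. Proof. by rewrite addr_ge0 ?sqr_ge0. Qed.
Lemma sqnM z w : sqn (z * w) = sqn z * sqn w.
Proof. by rewrite /sqn ReM ImM; ring. Qed.
Lemma sqnD z w : sqn (z + w) <= 2 * sqn z + 2 * sqn w.
Proof.
rewrite /sqn ReD ImD; have := sqr_ge0 (Re z - Re w).
have := sqr_ge0 (Im z - Im w); nra.
Qed.
(** Expanding the square t^-1 (t |a| - |b|)^2 >= 0 gives this weighted AM-GM inequality. The free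
    weight [t] lets the first term be made small when inner products are passed to a limit. *)
Lemma ReMconj_le z w (t : R) : 0 < t ->
  `|Re (z * w^*%C)| <= t * sqn z + t^-1 * sqn w.
Proof.
move=> t0; rewrite ReM Reconj Imconj /sqn.
have key a b : `|a * b| <= t * a ^+ 2 + t^-1 * b ^+ 2.
  have := sqr_ge0 (t * `|a| - `|b|); rewrite normrM.
  have : t * t^-1 = 1 by rewrite divff ?gt_eqF.
  have t'0 : 0 < t^-1 by rewrite invr_gt0.
  rewrite -(real_normK (num_real a)) -(real_normK (num_real b)).
  have := normr_ge0 a; have := normr_ge0 b.
  set x := `|a|; set y := `|b| => y0 x0 tt sq.
  have h : 0 <= t^-1 * (t * x - y) ^+ 2 by rewrite mulr_ge0 // ltW.
  have e : t^-1 * (t * x - y) ^+ 2 =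
    (t * t^-1) * t * x ^+ 2 - 2 * (t * t^-1) * x * y + t^-1 * y ^+ 2 by ring.
  rewrite e tt in h; nra.
rewrite mulrN opprK.
apply: (le_trans (ler_normD _ _)).
have := key (Re z) (Re w); have := key (Im z) (Im w); lra.
Qed.
(** Multiplying [z] by i turns the imaginary part into minus the real part and preserves [sqn]. *)
Lemma ImMconj_le z w (t : R) : 0 < t ->
  `|Im (z * w^*%C)| <= t * sqn z + t^-1 * sqn w.
Proof.
move=> t0; have := @ReMconj_le ('i * z) w t t0.
rewrite -mulrA ReM sqnM /= mul0r sub0r mul1r normrN => /le_trans; apply.
by rewrite /sqn /= expr0n expr1n add0r mul1r.
Qed.
End ComplexParts.

Section L2Theory.
Context {d : measure_display} {T : measurableType d} {R : realType}.
Variable mu : {measure set T -> \bar R}.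
Implicit Types (f g : T -> R[i]).
Local Notation Re := (@complex.Re R).
Local Notation Im := (@complex.Im R).

Definition cintegrable f :=
  mu.-integrable setT (EFin \o (fun x => Re (f x))) /\
  mu.-integrable setT (EFin \o (fun x => Im (f x))).

Definition cmeasurable f :=
  measurable_fun setT (fun x => Re (f x)) /\
  measurable_fun setT (fun x => Im (f x)).

Lemma cintegrableD f g : cintegrable f -> cintegrable g ->
  cintegrable (fun x => f x + g x).
Proof.
move=> [f1 f2] [g1 g2]; split.
  by apply: eq_integrable (integrableD measurableT f1 g1) => // x _;
    rewrite /= ReD EFinD.
by apply: eq_integrable (integrableD measurableT f2 g2) => // x _;
  rewrite /= ImD EFinD.
Qed.

Lemma cintegralD f g : cintegrable f -> cintegrable g ->
  cintegral mu (fun x => f x + g x) = cintegral mu f + cintegral mu g.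
Proof.
move=> [f1 f2] [g1 g2]; rewrite /cintegral; apply: complexP.
  rewrite ReD /= -RintegralD //; apply: eq_Rintegral => x _; exact: ReD.
rewrite ImD /= -RintegralD //; apply: eq_Rintegral => x _; exact: ImD.
Qed.

Lemma cintegrableZ (c : R[i]) f : cintegrable f -> cintegrable (fun x => c * f x).
Proof.
move=> [f1 f2]; split.
  apply: eq_integrable (integrableB measurableT
    (integrableZl measurableT (Re c) f1) (integrableZl measurableT (Im c) f2)) => //.
  by move=> x _; rewrite /= ReM EFinB !EFinM.
apply: eq_integrable (integrableD measurableT
    (integrableZl measurableT (Re c) f2) (integrableZl measurableT (Im c) f1)) => //.
by move=> x _; rewrite /= ImM EFinD !EFinM.
Qed.

Lemma cintegralZ (c : R[i]) f : cintegrable f ->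
  cintegral mu (fun x => c * f x) = c * cintegral mu f.
Proof.
move=> [f1 f2].
have i1 k : mu.-integrable setT (EFin \o (fun x => k * Re (f x))).
  by apply: eq_integrable (integrableZl measurableT k f1) => // x _ /=; rewrite EFinM.
have i2 k : mu.-integrable setT (EFin \o (fun x => k * Im (f x))).
  by apply: eq_integrable (integrableZl measurableT k f2) => // x _ /=; rewrite EFinM.
apply: complexP.
  rewrite ReM /= -!RintegralZl // -RintegralB //.
  by apply: eq_Rintegral => x _; exact: ReM.
rewrite ImM /= -!RintegralZl // -RintegralD //.
by apply: eq_Rintegral => x _; exact: ImM.
Qed.

Lemma eq_cintegral f g : f =1 g -> cintegral mu f = cintegral mu g.
Proof. by move=> /funext ->. Qed.

Lemma cintegrableB f g : cintegrable f -> cintegrable g ->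
  cintegrable (fun x => f x - g x).
Proof.
move=> fi gi; have -> : (fun x => f x - g x) = (fun x => f x + (-1) * g x).
  by apply/funext => x; rewrite mulN1r.
by apply: cintegrableD => //; exact: cintegrableZ.
Qed.

Lemma cintegralB f g : cintegrable f -> cintegrable g ->
  cintegral mu (fun x => f x - g x) = cintegral mu f - cintegral mu g.
Proof.
move=> fi gi; have -> : (fun x => f x - g x) = (fun x => f x + (-1) * g x).
  by apply/funext => x; rewrite mulN1r.
by rewrite cintegralD ?cintegralZ ?mulN1r //; exact: cintegrableZ.
Qed.

Lemma cintegral0 : cintegral mu (fun=> 0) = 0.
Proof. by rewrite /cintegral /= Rintegral_cst // mul0r. Qed.

Lemma cintegrable0 : cintegrable (fun=> 0).
Proof. by split; exact: integrable0. Qed.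

Lemma cintegrable_sum I (r : seq I) (F : I -> T -> R[i]) :
  (forall i, cintegrable (F i)) -> cintegrable (fun x => \sum_(i <- r) F i x).
Proof.
move=> iF; elim: r => [|i r IH].
  by under eq_fun do rewrite big_nil; exact: cintegrable0.
by under eq_fun do rewrite big_cons; exact: cintegrableD.
Qed.

Lemma cintegral_sum I (r : seq I) (F : I -> T -> R[i]) :
  (forall i, cintegrable (F i)) ->
  cintegral mu (fun x => \sum_(i <- r) F i x) = \sum_(i <- r) cintegral mu (F i).
Proof.
move=> iF; elim: r => [|i r IH].
  rewrite big_nil; under eq_cintegral do rewrite big_nil; exact: cintegral0.
rewrite big_cons -IH -cintegralD //; last exact: cintegrable_sum.
by apply: eq_cintegral => x; rewrite big_cons.
Qed.

Lemma Re_indic (A : set T) x : Re (\1_A x) = \1_A x.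
Proof. by rewrite !indicE Re_nat. Qed.

Lemma Im_indic (A : set T) x : Im (\1_A x) = 0.
Proof. by rewrite !indicE Im_nat. Qed.

Lemma cmeasurable_indic (A : set T) : measurable A -> cmeasurable \1_A.
Proof.
move=> mA; split.
  under eq_fun do rewrite Re_indic; exact: measurable_indic.
by under eq_fun do rewrite Im_indic; exact: measurable_cst.
Qed.

Lemma cintegrable_indic (A : set T) : measurable A -> (mu A < +oo)%E ->
  cintegrable \1_A.
Proof.
move=> mA Aoo; split; last first.
  apply: (@eq_integrable _ _ _ _ _ measurableT (cst 0%E)); last exact: integrable0.
  by move=> x _; rewrite /= Im_indic.
apply/integrableP; split.
  by apply/measurable_EFinP; exact: (cmeasurable_indic mA).1.
rewrite (eq_integral (fun x => (\1_A x)%:E)).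
  by rewrite integral_indic // setIT.
by move=> x _ /=; rewrite Re_indic ger0_norm.
Qed.

Lemma cintegral_indic (A : set T) : measurable A ->
  cintegral mu \1_A = (fine (mu A))%:C.
Proof.
move=> mA; apply: complexP => /=.
  rewrite (@eq_Rintegral _ _ _ _ _ \1_A); last by move=> x _; rewrite Re_indic.
  by rewrite /Rintegral integral_indic // setIT.
rewrite (@eq_Rintegral _ _ _ _ _ (cst 0)); last by move=> x _; rewrite Im_indic.
by rewrite Rintegral_cst // mul0r.
Qed.

Lemma cmeasurableD f g : cmeasurable f -> cmeasurable g ->
  cmeasurable (fun x => f x + g x).
Proof.
move=> [f1 f2] [g1 g2]; split.
  by under eq_fun do rewrite ReD; exact: measurable_funD.
by under eq_fun do rewrite ImD; exact: measurable_funD.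
Qed.

Lemma cmeasurableM f g : cmeasurable f -> cmeasurable g ->
  cmeasurable (fun x => f x * g x).
Proof.
move=> [f1 f2] [g1 g2]; split.
  by under eq_fun do rewrite ReM; apply: measurable_funB; exact: measurable_funM.
by under eq_fun do rewrite ImM; apply: measurable_funD; exact: measurable_funM.
Qed.

Lemma cmeasurable_cst (c : R[i]) : cmeasurable (fun=> c).
Proof. by split; exact: measurable_cst. Qed.

Lemma cmeasurable_conj f : cmeasurable f -> cmeasurable (fun x => (f x)^*%C).
Proof.
move=> [f1 f2]; split; first by under eq_fun do rewrite Reconj.
by under eq_fun do rewrite Imconj; exact: measurableT_comp.
Qed.

Lemma measurable_sqn f : cmeasurable f -> measurable_fun setT (fun x => sqn (f x)).
Proof. by move=> [f1 f2]; apply: measurable_funD; exact: measurable_funX. Qed.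

Lemma L2P f : L2 mu f <-> cmeasurable f /\ (normsq mu f < +oo)%E.
Proof. by split=> [[]|[[]]]. Qed.

Lemma normsq_ge0 f : (0 <= normsq mu f)%E.
Proof. by apply: integral_ge0 => x _; rewrite lee_fin; exact: sqn_ge0. Qed.

Lemma normsqZ (c : R[i]) f : cmeasurable f ->
  normsq mu (fun x => c * f x) = ((sqn c)%:E * normsq mu f)%E.
Proof.
move=> mf; rewrite /normsq -ge0_integralZl //.
- by apply: eq_integral => x _; rewrite -EFinM -sqnM.
- by apply/measurable_EFinP; exact: measurable_sqn.
- by move=> x _; rewrite lee_fin; exact: sqn_ge0.
- by rewrite lee_fin; exact: sqn_ge0.
Qed.

(** The pointwise bound |z + w|^2 <= 2 |z|^2 + 2 |w|^2 is integrated; it stands in for the triangle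
    inequality, and its factors 2 are the origin of [eps / 4] in the approximations. *)
Lemma normsqD f g : cmeasurable f -> cmeasurable g ->
  (normsq mu (fun x => (f x + g x)%R) <= 2%:E * normsq mu f + 2%:E * normsq mu g)%E.
Proof.
move=> mf mg.
have mE h : cmeasurable h -> measurable_fun setT (fun x => (sqn (h x))%:E).
  by move=> mh; apply/measurable_EFinP; exact: measurable_sqn.
have ge h x : (0 <= (sqn (h x))%:E)%E by rewrite lee_fin; exact: sqn_ge0.
rewrite /normsq -!ge0_integralZl //; try by [apply: mE|move=> x _; exact: ge].
have m2 h : cmeasurable h -> measurable_fun setT (fun x => (2%:E * (sqn (h x))%:E)%E).
  by move=> mh; apply: measurable_funeM; exact: mE.
have ge2 h x : (0 <= 2%:E * (sqn (h x))%:E)%E by rewrite mule_ge0.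
rewrite -ge0_integralD //; try by [apply: m2|move=> x _; exact: ge2].
apply: ge0_le_integral => //.
- by move=> x _; rewrite lee_fin; exact: sqn_ge0.
- exact: (mE (fun x => f x + g x) (cmeasurableD mf mg)).
- by apply: emeasurable_funD; exact: m2.
- by move=> x _; rewrite -!EFinM -EFinD lee_fin; exact: sqnD.
Qed.

Lemma L2D f g : L2 mu f -> L2 mu g -> L2 mu (fun x => f x + g x).
Proof.
move=> /L2P[mf f2] /L2P[mg g2]; apply/L2P; split; first exact: cmeasurableD.
apply: (le_lt_trans (normsqD mf mg)).
by rewrite lte_add_pinfty // lte_mul_pinfty.
Qed.

Lemma L2Z (c : R[i]) f : L2 mu f -> L2 mu (fun x => c * f x).
Proof.
move=> /L2P[mf f2]; apply/L2P; split.
  by apply: cmeasurableM => //; exact: cmeasurable_cst.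
by rewrite normsqZ // lte_mul_pinfty // lee_fin sqn_ge0.
Qed.

Lemma L2_0 : L2 mu (fun=> 0).
Proof.
apply/L2P; split; first exact: cmeasurable_cst.
rewrite /normsq; under eq_integral do rewrite /= expr0n addr0.
by rewrite integral0.
Qed.

Lemma L2N f : L2 mu f -> L2 mu (fun x => - f x).
Proof.
by move=> /(L2Z (-1)); under eq_fun do rewrite mulN1r.
Qed.

Lemma L2B f g : L2 mu f -> L2 mu g -> L2 mu (fun x => f x - g x).
Proof. by move=> f2 g2; exact: L2D f2 (L2N g2). Qed.

Lemma L2_sum I (r : seq I) (F : I -> T -> R[i]) :
  (forall i, L2 mu (F i)) -> L2 mu (fun x => \sum_(i <- r) F i x).
Proof.
move=> iF; elim: r => [|i r IH].
  by under eq_fun do rewrite big_nil; exact: L2_0.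
by under eq_fun do rewrite big_cons; exact: L2D.
Qed.

Lemma normsq_indic (A : set T) : measurable A -> normsq mu \1_A = mu A.
Proof.
move=> mA; rewrite -[in RHS](setIT A) -integral_indic //.
apply: eq_integral => x _; rewrite Re_indic Im_indic expr0n addr0 indicE.
by case: (x \in A); rewrite ?expr1n ?expr0n.
Qed.

Lemma L2_indic (A : set T) : measurable A -> (mu A < +oo)%E -> L2 mu \1_A.
Proof.
move=> mA Aoo; apply/L2P; split; first exact: cmeasurable_indic.
by rewrite normsq_indic.
Qed.

Lemma L2_sqn_integrable f : L2 mu f ->
  mu.-integrable setT (EFin \o (fun x => sqn (f x))).
Proof.
move=> /L2P[mf f2]; apply/integrableP; split.
  by apply/measurable_EFinP; exact: measurable_sqn.
under eq_integral do rewrite /= ger0_norm ?sqn_ge0 //.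
exact: f2.
Qed.

Lemma normsq_fine f : L2 mu f ->
  (\int[mu]_x sqn (f x)) = fine (normsq mu f).
Proof. by []. Qed.

(** AM-GM at weight 1 dominates both parts of the product by [sqn f + sqn g]. *)
Lemma L2M_integrable f g : L2 mu f -> L2 mu g ->
  cintegrable (fun x => f x * (g x)^*%C).
Proof.
move=> f2 g2.
have [/L2P[mf _] /L2P[mg _]] := (f2, g2).
have [m1 m2] := cmeasurableM mf (cmeasurable_conj mg).
have i : mu.-integrable setT (EFin \o (fun x => sqn (f x) + sqn (g x))).
  exact: eq_integrable (integrableD measurableT
    (L2_sqn_integrable f2) (L2_sqn_integrable g2)).
have le x : `|Re (f x * (g x)^*%C)| <= sqn (f x) + sqn (g x).
  by have := ReMconj_le (f x) (g x) (@ltr01 R); rewrite invr1 !mul1r.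
have le' x : `|Im (f x * (g x)^*%C)| <= sqn (f x) + sqn (g x).
  by have := ImMconj_le (f x) (g x) (@ltr01 R); rewrite invr1 !mul1r.
split; apply: le_integrable i => //; try by apply/measurable_EFinP.
  by move=> x _ /=; rewrite lee_fin (ger0_norm (addr_ge0 (sqn_ge0 _) (sqn_ge0 _))).
by move=> x _ /=; rewrite lee_fin (ger0_norm (addr_ge0 (sqn_ge0 _) (sqn_ge0 _))).
Qed.

Lemma cintegral_conj f : cintegrable f ->
  cintegral mu (fun x => (f x)^*%C) = (cintegral mu f)^*%C.
Proof.
move=> [f1 f2]; apply: complexP; rewrite ?Reconj ?Imconj /=.
  by apply: eq_Rintegral => x _; rewrite Reconj.
by rewrite -mulN1r -RintegralZl //; apply: eq_Rintegral => x _; rewrite Imconj mulN1r.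
Qed.

Lemma cdotC f g : cintegrable (fun x => g x * (f x)^*%C) ->
  cdot mu f g = (cdot mu g f)^*%C.
Proof.
move=> i; rewrite /cdot -cintegral_conj //; apply: eq_cintegral => x.
case: (f x) => a b; case: (g x) => a' b'; apply: complexP => /=; ring.
Qed.

Lemma cdot_le_amgm f g (t : R) : L2 mu f -> L2 mu g -> 0 < t ->
  `|Re (cdot mu f g)| <= t * fine (normsq mu f) + t^-1 * fine (normsq mu g) /\
  `|Im (cdot mu f g)| <= t * fine (normsq mu f) + t^-1 * fine (normsq mu g).
Proof.
move=> f2 g2 t0.
have [i1 i2] := L2M_integrable f2 g2.
have jf := L2_sqn_integrable f2; have jg := L2_sqn_integrable g2.
have jZ k h : mu.-integrable setT (EFin \o h) ->
    mu.-integrable setT (EFin \o (fun x => k * h x)).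
  by move=> j; apply: eq_integrable (integrableZl measurableT k j).
rewrite -!normsq_fine // -!RintegralZl // -RintegralD //; try exact: jZ.
have j : mu.-integrable setT (EFin \o (fun x => t * sqn (f x) + t^-1 * sqn (g x))).
  exact: eq_integrable (integrableD measurableT (jZ t _ jf) (jZ t^-1 _ jg)).
split; apply: (le_trans (le_normr_Rintegral measurableT _)) => //;
  apply: le_Rintegral => //.
- exact: integrable_norm i1.
- by move=> x _; exact: ReMconj_le.
- exact: integrable_norm i2.
- by move=> x _; exact: ImMconj_le.
Qed.

(** Serves to show that a normalised basis function is not almost everywhere zero, as an eigenvector
    must not be. *)
Lemma cdot_ae0 f g : L2 mu f -> L2 mu g -> {ae mu, forall x, f x = 0} ->
  cdot mu f g = 0.
Proof.
move=> f2 g2 f0; have [i1 i2] := L2M_integrable f2 g2.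
have m0 : measurable_fun setT (cst 0%E : T -> \bar R) by exact: measurable_cst.
have z (k : T -> R) : mu.-integrable setT (EFin \o k) ->
    (forall x, f x = 0 -> k x = 0) -> \int[mu]_(x in setT) k x = 0.
  move=> ik k0; rewrite /Rintegral (ae_eq_integral (cst 0%E)) ?integral0 //.
    exact: measurable_int ik.
  by apply: filterS f0 => x fx _; rewrite /= k0.
by rewrite /cdot /cintegral !z // => x ->; rewrite mul0r.
Qed.

Lemma cdotZl (c : R[i]) f g : L2 mu f -> L2 mu g ->
  cdot mu (fun x => c * f x) g = c * cdot mu f g.
Proof.
move=> f2 g2; rewrite /cdot -cintegralZ; last exact: L2M_integrable.
by apply: eq_cintegral => x; rewrite mulrA.
Qed.

Lemma cdot_sumr n (c : 'I_n -> R[i]) (e : 'I_n -> T -> R[i]) f :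
  L2 mu f -> (forall i, L2 mu (e i)) ->
  cdot mu f (fun x => \sum_(i < n) c i * e i x) =
  \sum_(i < n) (c i)^* * cdot mu f (e i).
Proof.
move=> f2 e2; rewrite /cdot.
transitivity (cintegral mu (fun x => \sum_(i < n) (c i)^* * (f x * (e i x)^*%C))).
  apply: eq_cintegral => x; rewrite rmorph_sum mulr_sumr.
  by apply: eq_bigr => i _; rewrite rmorphM mulrCA.
rewrite cintegral_sum; last first.
  by move=> i; apply: cintegrableZ; exact: L2M_integrable.
by apply: eq_bigr => i _; rewrite cintegralZ //; exact: L2M_integrable.
Qed.

Lemma L2_span (S : set (T -> R[i])) : S `<=` L2 mu -> span S `<=` L2 mu.
Proof.
move=> SL g [n [c [e [Se ge]]]].
rewrite (_ : g = fun x => \sum_(i < n) c i * e i x); last exact/funext.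
by apply: L2_sum => i; apply: L2Z; exact: SL.
Qed.

(* Take [eps = t^2] in the AM-GM bound [t ||f||^2 + t^-1 ||g - g'||^2]. *)
Lemma cdot_closed_span_eq0 (S : set (T -> R[i])) f g : L2 mu f -> S `<=` L2 mu ->
  (forall s, S s -> cdot mu f s = 0) -> closed_span mu S g -> cdot mu f g = 0.
Proof.
move=> f2 SL fS [g2 gS].
have H t : 0 < t ->
    `|Re (cdot mu f g)| <= t * (fine (normsq mu f) + 1) /\
    `|Im (cdot mu f g)| <= t * (fine (normsq mu f) + 1).
  move=> t0; have tt0 : 0 < t ^+ 2 by rewrite exprn_gt0.
  have [g' g'S dg] := gS _ tt0.
  have g'2 := L2_span SL g'S.
  have fg'0 : cdot mu f g' = 0.
    move: g'S => [n [c [e [Se ge]]]].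
    rewrite (_ : g' = fun x => \sum_(i < n) c i * e i x); last exact/funext.
    rewrite cdot_sumr //; last by move=> i; exact: SL.
    by apply: big1 => i _; rewrite fS // mulr0.
  have dg2 := L2B g2 g'2.
  have -> : cdot mu f g = cdot mu f (fun x => g x - g' x).
    rewrite -[RHS]addr0 -[X in _ + X]fg'0 /cdot -cintegralD; try exact: L2M_integrable.
    by apply: eq_cintegral => x; rewrite -mulrDr -rmorphD subrK.
  have [h1 h2] := cdot_le_amgm f2 dg2 t0.
  have le : t^-1 * fine (normsq mu (fun x => g x - g' x)) <= t.
    rewrite ler_pdivrMl // -expr2 -lee_fin fineK; first exact: ltW.
    by rewrite ge0_fin_numE ?normsq_ge0 //; case: dg2.
  by split; apply: le_trans; [exact: h1| |exact: h2|]; rewrite mulrDr mulr1 lerD2l.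
have N0 : 0 < fine (normsq mu f) + 1.
  by rewrite ltr_wpDl // fine_ge0 // normsq_ge0.
have zero (r : R) : (forall t, 0 < t -> `|r| <= t * (fine (normsq mu f) + 1)) -> r = 0.
  move=> hr; apply/eqP; rewrite -normr_eq0; apply/eqP/le_anti.
  rewrite normr_ge0 andbT leNgt; apply/negP => r0.
  have := hr (`|r| / 2 / (fine (normsq mu f) + 1)).
  rewrite divfK ?gt_eqF // !divr_gt0 // => /(_ isT); lra.
by apply: complexP; apply: zero => t /H [].
Qed.

Lemma lt_double_quarters (a b : \bar R) (eps : R) :
  (a < (eps / 4)%:E -> b < (eps / 4)%:E -> 2%:E * a + 2%:E * b < eps%:E)%E.
Proof.
move=> ha hb.
have -> : (eps%:E = 2%:E * (eps / 4)%:E + 2%:E * (eps / 4)%:E)%E.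
  by rewrite -!EFinM -EFinD; congr EFin; lra.
by apply: lteD; rewrite lte_pmul2l.
Qed.

Section ClosedSpan.
Variable S : set (T -> R[i]).
Hypothesis SL : S `<=` L2 mu.
Local Notation V := (closed_span mu S).

Lemma span_id s : S s -> span S s.
Proof.
move=> Ss; exists 1%N, (fun=> 1), (fun=> s); split => // x.
by rewrite big_ord1 mul1r.
Qed.

Lemma span0 : span S (fun=> 0).
Proof. by exists 0%N, (fun=> 0), (fun=> fun=> 0); split=> [[]//|x]; rewrite big_ord0. Qed.

Lemma spanZ (c : R[i]) f : span S f -> span S (fun x => c * f x).
Proof.
move=> [n [a [e [Se fe]]]]; exists n, (fun i => c * a i), e; split => // x.
by rewrite fe mulr_sumr; apply: eq_bigr => i _; rewrite mulrA.
Qed.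

Lemma spanD f g : span S f -> span S g -> span S (fun x => f x + g x).
Proof.
move=> [n [a [e [Se fe]]]] [m [b [e' [Se' ge]]]].
exists (n + m)%N, (fun i => match fintype.split i with inl j => a j | inr j => b j end),
  (fun i => match fintype.split i with inl j => e j | inr j => e' j end); split.
  by move=> i; case: (fintype.split i).
move=> x; rewrite fe ge big_split_ord /=; congr (_ + _).
  by apply: eq_bigr => i _; rewrite (unsplitK (inl i)).
by apply: eq_bigr => i _; rewrite (unsplitK (inr i)).
Qed.

Lemma span_big I (r : seq I) (F : I -> T -> R[i]) :
  (forall i, span S (F i)) -> span S (fun x => \sum_(i <- r) F i x).
Proof.
move=> iF; elim: r => [|i r IH].
  by under eq_fun do rewrite big_nil; exact: span0.
by under eq_fun do rewrite big_cons; exact: spanD.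
Qed.

Lemma span_closed_span : span S `<=` V.
Proof.
move=> f Sf; split; first exact: L2_span Sf.
move=> eps e0; exists f => //; rewrite /normsq.
under eq_integral do rewrite subrr /= expr0n addr0.
by rewrite integral0 lte_fin.
Qed.

Lemma closed_span_approx f : L2 mu f ->
  (forall eps : R, 0 < eps -> exists2 g, V g &
     (normsq mu (fun x => (f x - g x)%R) < eps%:E)%E) -> V f.
Proof.
move=> f2 h; split => // eps e0.
have e4 : 0 < eps / 4 by rewrite divr_gt0.
have [g [g2 gV] fg] := h _ e4; have [k kS gk] := gV _ e4.
exists k => //.
have k2 := L2_span SL kS.
have [/L2P[m1 _] /L2P[m2 _]] := (L2B f2 g2, L2B g2 k2).
have -> : (fun x => f x - k x) = (fun x => (f x - g x) + (g x - k x)).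
  by apply/funext => x; ring.
apply: (le_lt_trans (normsqD m1 m2)).
exact: lt_double_quarters.
Qed.

Lemma closed_spanD f g : V f -> V g -> V (fun x => f x + g x).
Proof.
move=> [f2 fV] [g2 gV]; split; first exact: L2D.
move=> eps e0; have e4 : 0 < eps / 4 by rewrite divr_gt0.
have [f' f'S ff] := fV _ e4; have [g' g'S gg] := gV _ e4.
exists (fun x => f' x + g' x); first exact: spanD.
have [f'2 g'2] := (L2_span SL f'S, L2_span SL g'S).
have [/L2P[m1 _] /L2P[m2 _]] := (L2B f2 f'2, L2B g2 g'2).
have -> : (fun x => f x + g x - (f' x + g' x)) =
          (fun x => (f x - f' x) + (g x - g' x)).
  by apply/funext => x; ring.
apply: (le_lt_trans (normsqD m1 m2)).
exact: lt_double_quarters.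
Qed.

Lemma closed_spanZ (c : R[i]) f : V f -> V (fun x => c * f x).
Proof.
move=> [f2 fV]; split; first exact: L2Z.
move=> eps e0.
(* The added 1 keeps the divisor positive when [c] is 0. *)
have c0 : 0 < sqn c + 1 by rewrite ltr_wpDl // sqn_ge0.
have e' : 0 < eps / (sqn c + 1) by rewrite divr_gt0.
have [g gS fg] := fV _ e'; exists (fun x => c * g x); first exact: spanZ.
have g2 := L2_span SL gS; have /L2P[m _] := L2B f2 g2.
have -> : (fun x => c * f x - c * g x) = (fun x => c * (f x - g x)).
  by apply/funext => x; rewrite mulrBr.
rewrite normsqZ //.
apply: (@le_lt_trans _ _ ((sqn c + 1)%:E * normsq mu (fun x => (f x - g x)%R))%E).
  by rewrite lee_wpmul2r ?normsq_ge0 // lee_fin lerDl.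
by rewrite -lte_pdivlMl // -EFinM mulrC.
Qed.

Lemma closed_span0 : V (fun=> 0).
Proof. by apply: span_closed_span; exact: span0. Qed.

Lemma closed_span_sum I (r : seq I) (F : I -> T -> R[i]) :
  (forall i, V (F i)) -> V (fun x => \sum_(i <- r) F i x).
Proof.
move=> iF; elim: r => [|i r IH].
  by under eq_fun do rewrite big_nil; exact: closed_span0.
by under eq_fun do rewrite big_cons; exact: closed_spanD.
Qed.

End ClosedSpan.
End L2Theory.

(** * Density: indicators of sets of finite measure generate L2 *)

Section L2Density.
Context {d : measure_display} {T : measurableType d} {R : realType}.
Variable mu : {measure set T -> \bar R}.
Implicit Types (f g : T -> R[i]).
Local Notation Re := (@complex.Re R).
Local Notation Im := (@complex.Im R).
Variable S : set (T -> R[i]).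
Hypothesis SL : S `<=` L2 mu.
Local Notation V := (closed_span mu S).

Lemma cvge0_lt (a : (\bar R)^nat) (eps : R) : a n @[n --> \oo] --> (0%E : \bar R) ->
  0 < eps -> exists n, (a n < eps%:E)%E.
Proof.
move=> a0 e0.
have [] := a0 [set y | (y < eps%:E)%E].
  apply: open_nbhs_nbhs; split; first exact: open_ereal_lt_ereal.
  by rewrite /= lte_fin.
by move=> m _ /(_ m (leqnn m)) h; exists m.
Qed.

Lemma indic_bigsetU (F : nat -> set T) m x : trivIset setT F ->
  \sum_(i < m) \1_(F i) x = \1_(\big[setU/set0]_(i < m) F i) x :> R[i].
Proof.
move=> tF; elim: m => [|m IH]; first by rewrite !big_ord0 indicE in_set0.
rewrite !big_ord_recr /= IH !indicE in_setU.
have [/set_mem xF|] := boolP (x \in F m); last by rewrite orbF addr0.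
rewrite orbT; have [/set_mem|] := boolP (_ \in _); last by rewrite add0r.
rewrite -bigcup_mkord => -[k /= km xk].
have /trivIsetP /(_ k m) := tF; rewrite ltn_eqF // => /(_ Logic.I Logic.I isT) e.
by have : (F k `&` F m) x by []; rewrite e.
Qed.

(** The squared distance from the indicator of the union to its [m]-th partial sum is the measure of
    the remainder [D m]. The remainders decrease to the empty set, and finiteness of the total
    measure allows continuity from above. *)
Lemma closed_span_bigcup (F : nat -> set T) : (forall n, measurable (F n)) ->
  trivIset setT F -> (mu (\bigcup_n F n) < +oo)%E ->
  (forall n, V \1_(F n)) -> V \1_(\bigcup_n F n).
Proof.
move=> mF tF Uoo VF.
set U := \bigcup_n F n.
have mU : measurable U by exact: bigcupT_measurable.
pose W m := \big[setU/set0]_(i < m) F i.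
have mW m : measurable (W m) by exact: bigsetU_measurable.
have WU m : W m `<=` U by rewrite /W -bigcup_mkord; apply: bigcup_sub => i _ x Fx; exists i.
pose D m := U `\` W m.
have mD m : measurable (D m) by exact: measurableD.
have Dle m : (mu (D m) <= mu U)%E by rewrite le_measure ?inE //; exact: subDsetl.
have capD : \bigcap_m D m = set0.
  rewrite -subset0 => x Dx; have [[n _ Fnx] _] := Dx 0%N Logic.I.
  have [_] := Dx n.+1 Logic.I; apply.
  by rewrite /W -bigcup_mkord; exists n => //=.
have cD : mu (D m) @[m --> \oo] --> (0%E : \bar R).
  rewrite -(measure0 mu) -capD; apply: nonincreasing_cvg_mu => //.
  - exact: le_lt_trans (Dle 0%N) Uoo.
  - by rewrite capD.
  - apply/nonincreasing_seqP => m; apply/subsetPset; apply: setDS.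
    by rewrite /W big_ord_recr /=; exact: subsetUl.
apply: closed_span_approx => //; first exact: L2_indic.
move=> eps e0.
have [m Dm] := cvge0_lt cD e0.
exists (fun x => \sum_(i < m) \1_(F i) x); first exact: closed_span_sum.
apply: le_lt_trans Dm; rewrite -normsq_indic // le_eqVlt; apply/orP; left.
apply/eqP; congr normsq; apply/funext => x.
rewrite indic_bigsetU // !indicE in_setD.
have [xW|] := boolP (x \in W m); last by rewrite subr0 andbT.
by rewrite (mem_set (WU m x (set_mem xW))) andbF subrr.
Qed.

Hypothesis VS : forall A, measurable A -> (mu A < +oo)%E -> V \1_A.

Import HBNNSimple.

Lemma closed_span_nneg (g : T -> R) : measurable_fun setT g ->
  (forall x, 0 <= g x) -> (\int[mu]_x ((g x) ^+ 2)%:E < +oo)%E ->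
  V (fun x => (g x)%:C).
Proof.
move=> mg g0 gfin.
have mgE : measurable_fun setT (EFin \o g) by apply/measurable_EFinP.
pose phi n : {nnsfun T >-> R} := nnsfun_approx measurableT mgE n.
have phile n x : phi n x <= g x.
  rewrite -lee_fin /phi nnsfun_approxE; apply: le_approx => //.
  by move=> y _ /=; rewrite lee_fin.
have phicvg x : (phi n x)%:E @[n --> \oo] --> (g x)%:E.
  exact: (cvg_nnsfun_approx measurableT mgE (fun y _ => g0 y) (x := x) Logic.I).
have mphi n : measurable_fun setT (phi n) by exact: measurable_funPT.
have ig : mu.-integrable setT (EFin \o (fun x => g x ^+ 2)).
  apply/integrableP; split; first by apply/measurable_EFinP; exact: measurable_funX.
  by under eq_integral do rewrite /= ger0_norm ?sqr_ge0 //.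
have g2 : L2 mu (fun x => (g x)%:C).
  split; [exact: mg|exact: measurable_cst|].
  by rewrite /normsq; under eq_integral do rewrite /= expr0n addr0.
have Vphi n : V (fun x => (phi n x)%:C).
  have -> : (fun x => (phi n x)%:C) =
      fun x =>
        \sum_(y <- finmap.enum_fset (fset_set (range (phi n)))) y%:C * \1_(phi n @^-1` [set y]) x.
    apply/funext => x; rewrite fimfunE fsbig_finite //= rmorph_sum.
    by apply: eq_bigr => y _; rewrite rmorphM !indicE rmorph_nat.
  apply: closed_span_sum => // y.
  (* The value 0 is set aside because its level set may have infinite measure. For [y != 0]
     Chebyshev's argument applies: [y ^+ 2] times the indicator of the level set is at most
     [g ^+ 2]. *)
  have [->|y0] := eqVneq y 0.
    by under eq_fun do rewrite mul0r; exact: closed_span0.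
  apply: closed_spanZ => //; apply: VS; first exact: measurable_sfunP.
  have y2 : 0 < y ^+ 2 by rewrite exprn_even_gt0.
  have mA : measurable (phi n @^-1` [set y]) by exact: measurable_sfunP.
  rewrite -(@lte_pmul2l _ (y ^+ 2)%:E) // mulry gtr0_sg // mul1e.
  apply: le_lt_trans gfin.
  rewrite -[X in (_ * mu X)%E]setIT -integral_indic // -ge0_integralZl //; last first.
- by rewrite lee_fin ltW.
- exact/measurable_EFinP/measurable_indic.
  apply: ge0_le_integral => //.
  - by move=> x _; rewrite -EFinM lee_fin mulr_ge0 // ltW.
  - by apply: measurable_funeM; exact/measurable_EFinP/measurable_indic.
  - by apply/measurable_EFinP; exact: measurable_funX.
  - move=> x _; rewrite -EFinM lee_fin indicE.
    have [/set_mem /= xy|_] := boolP (_ \in _); last by rewrite mulr0 sqr_ge0.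
    rewrite mulr1 -xy ler_pXn2r ?nnegrE //.
apply: closed_span_approx => // eps e0.
(* Since [0 <= phi n <= g], the squared errors are dominated by the integrable function [g ^+ 2]. *)
have [|||_ _] := @dominated_convergence _ _ _ mu setT measurableT
  (fun n x => ((g x - phi n x) ^+ 2)%:E) (cst 0%E) (EFin \o (fun x => g x ^+ 2)) _
  (@measurable_cst _ _ _ _ setT 0%E) _ ig _.
- by move=> n; apply/measurable_EFinP; apply: measurable_funX; exact: measurable_funB.
- apply: aeW => x _.
  have -> : cst 0%E x = ((g x - g x) ^+ 2)%:E by rewrite subrr expr0n.
  apply: cvg_EFin; first by near=> n.
  have c : phi n x @[n --> \oo] --> g x.
    by have /fine_cvgP[_] := phicvg x.
  by apply: (@cvgM R); apply: cvgB => //; exact: cvg_cst.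
- apply: aeW => x n _; rewrite /= lee_fin ger0_norm ?sqr_ge0 //.
  have p0 : 0 <= phi n x by [].
  have := phile n x; have := g0 x; nra.
rewrite integral0 => /cvge0_lt /(_ e0) [n gn].
exists (fun x => (phi n x)%:C) => //.
apply: le_lt_trans gn; rewrite /normsq le_eqVlt; apply/orP; left; apply/eqP.
by apply: eq_integral => x _; rewrite ReD ReN ImD ImN /= subr0 expr0n addr0.
Unshelve. all: by end_near. Qed.

Lemma L2_closed_span : L2 mu `<=` V.
Proof.
move=> f f2.
have [m1 m2 nf] := f2.
have Vreal (h : T -> R) : measurable_fun setT h -> (forall x, h x ^+ 2 <= sqn (f x)) ->
    V (fun x => (h x)%:C).
  move=> mh hf.
  have H (k : T -> R) : measurable_fun setT k -> (forall x, 0 <= k x) ->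
      (forall x, k x <= `|h x|) -> V (fun x => (k x)%:C).
    move=> mk k0 kh; apply: closed_span_nneg => //.
    apply: le_lt_trans nf; apply: ge0_le_integral => //.
    - by move=> x _; rewrite lee_fin sqr_ge0.
    - by apply/measurable_EFinP; exact: measurable_funX.
    - by apply/measurable_EFinP; exact: measurable_sqn.
    - move=> x _; rewrite lee_fin; apply: le_trans (hf x).
      by rewrite -[leRHS]real_normK ?num_real // ler_pXn2r ?nnegrE.
  have -> : (fun x => (h x)%:C) =
      (fun x => (Num.max (h x) 0)%:C + (-1) * (Num.max (- h x) 0)%:C).
    apply/funext => x; rewrite mulN1r -rmorphB /=; congr (_%:C).
    by case: (leP (h x) 0) => h0; case: (leP (- h x) 0); lra.
  apply: closed_spanD => //; last apply: closed_spanZ => //; apply: H.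
  - by apply: measurable_maxr => //; exact: measurable_cst.
  - by move=> x; rewrite le_max lexx orbT.
  - by move=> x; rewrite ge_max normr_ge0 ler_norm.
  - by apply: measurable_maxr; [exact: measurableT_comp|exact: measurable_cst].
  - by move=> x; rewrite le_max lexx orbT.
  - by move=> x; rewrite ge_max normr_ge0 -normrN ler_norm.
have -> : f = (fun x => (Re (f x))%:C + 'i%C * (Im (f x))%:C).
  by apply/funext => x; exact: complexE.
apply: closed_spanD => //; last apply: closed_spanZ => //; apply: Vreal => // x.
  by rewrite /sqn lerDl sqr_ge0.
by rewrite /sqn lerDr sqr_ge0.
Qed.
End L2Density.

(** * Topology of the path space and of the groupoid *)

Section PathTopology.
Variables (N : nat) (A : 'M[bool]_N.+1) (hA : primitive A).
Local Notation X := (path_space hA).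
Local Notation discN := (discrete_topology 'I_N.+1).
Local Notation P := (prod_topology (fun _ : nat => discN)).

(* The filter of sets containing such a cylinder converges to [x] coordinatewise. *)
Lemma nbhs_prodP (x : P) (U : set P) : nbhs x U ->
  exists n, forall y : P, (forall i, (i < n)%N -> y i = x i) -> U y.
Proof.
pose F : set_system P := filter_from setT
  (fun n : nat => [set y : P | forall i, (i < n)%N -> y i = x i]).
have FF : Filter F.
  apply: filter_from_filter; first by exists 0%N.
  move=> i j _ _; exists (maxn i j) => // y yij; split=> k ki; apply: yij.
    exact: leq_trans ki (leq_maxl _ _).
  exact: leq_trans ki (leq_maxr _ _).
suff Fx : F --> x by move=> /Fx [n _ nU]; exists n => y /nU.
apply/cvg_sup => i U' [_ [[W oW <-] Wx sWU]].
by exists i.+1 => // y yx; apply: sWU; rewrite /= yx.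
Qed.

Lemma coord_inj (x y : X) : coord x =1 coord y -> x = y.
Proof.
move=> h; apply: val_inj; apply: functional_extensionality_dep => n; exact: h.
Qed.

Lemma coord_adm (x : X) n : A (coord x n) (coord x n.+1).
Proof. exact: (set_mem (svalP x)). Qed.

Lemma coord_shift (x : X) k n : coord (iter k (@shift _ _ hA) x) n =coord x (n + k).
Proof. by elim: k n => [|k IH] n; rewrite ?addn0 // iterS addnS -addSn -IH. Qed.

Lemma size_initial_word (x : X) n : size (initial_word x n) = n.
Proof. exact: size_mkseq. Qed.

Lemma nth_initial_word (x : X) n i a :
  (i < n)%N -> nth a (initial_word x n) i = coord x i.
Proof. exact: nth_mkseq. Qed.

Lemma initial_wordS (x : X) n :
  initial_word x n.+1 = rcons (initial_word x n) (coord x n).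
Proof.
have e : iota 0 n.+1 = rcons (iota 0 n) n by rewrite -addn1 iotaD cats1.
by rewrite /initial_word /mkseq e map_rcons.
Qed.

Lemma initial_wordP (x y : X) n : initial_word x n = initial_word y n <->
  forall i, (i < n)%N -> coord x i = coord y i.
Proof.
split=> [e i lin|e]; first by rewrite -!(nth_initial_word _ ord0 lin) e.
apply: (@eq_from_nth _ ord0); rewrite !size_initial_word // => i lin.
by rewrite !nth_initial_word // e.
Qed.

Lemma take_initial_word (x : X) m n :
  (m <= n)%N -> take m (initial_word x n) = initial_word x m.
Proof. by move=> mn; rewrite /initial_word /mkseq -map_take take_iota (minn_idPl mn). Qed.

Lemma initial_word_le (x y : X) m n : (m <= n)%N ->
  initial_word x n = initial_word y n -> initial_word x m = initial_word y m.
Proof. by move=> mn e; rewrite -!(take_initial_word _ mn) e. Qed.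

Lemma admissible_initial_word (x : X) n : admissible A (initial_word x n).
Proof.
rewrite /admissible; case: n => // n; apply/(pathP ord0) => i.
rewrite size_map size_iota => lin.
rewrite -[nth _ (map _ _) i]/(nth ord0 (initial_word x n.+1) i.+1).
rewrite -[_ :: _]/(initial_word x n.+1) !nth_initial_word //; last exact: ltnW.
exact: coord_adm.
Qed.

Lemma cylP (w : word N) (x : X) :
  cyl w x <-> forall i, (i < size w)%N -> coord x i = nth ord0 w i.
Proof.
split=> [<- i|h]; rewrite ?size_initial_word; first by move/nth_initial_word ->.
apply: (@eq_from_nth _ ord0); rewrite size_initial_word // => i iw.
by rewrite nth_initial_word // h.
Qed.

Lemma cyl_initial_word (x y : X) n :
  cyl (initial_word x n) y <-> initial_word y n = initial_word x n.
Proof. by rewrite /cyl /= size_initial_word. Qed.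

Lemma cyl_take (w : word N) n (x : X) : cyl w x -> cyl (take n w) x.
Proof.
move=> /cylP h; apply/cylP => i; rewrite size_take_min leq_min => /andP[i1 i2].
by rewrite nth_take // h.
Qed.

Lemma cyl_cat (w w' : word N) (x : X) : cyl (w ++ w') x -> cyl w x.
Proof. by move=> /(cyl_take (size w)); rewrite take_size_cat. Qed.

Lemma cyl_prefix (w w' : word N) : prefix w w' -> @cyl _ _ hA w' `<=` cyl w.
Proof. by move=> /prefixP[s ->] x; exact: cyl_cat. Qed.

Lemma cyl_admissible (w : word N) (x : X) : cyl w x -> admissible A w.
Proof. by move=> <-; exact: admissible_initial_word. Qed.

Lemma cyl_nonempty (w : word N) : admissible A w -> exists x : X, cyl w x.
Proof.
move=> Aw; case: w Aw => [|a w] Aw; first by exists (some_path hA).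
pose f i := xchoose (primitive_succ hA i).
(* The word is [a :: w], so [size w] is the position of its last letter. The iteration of chosen
   successors starts there, and the two formulas agree at that position. *)
pose c n := if (n < size (a :: w))%N then nth a (a :: w) n
  else iter (n - size w) f (last a w).
have cS n : (size w <= n)%N -> c n = iter (n - size w) f (last a w).
  rewrite /c /= ltnS => wn; case: ltngtP wn => // <- _.
  by rewrite subnn; exact: (nth_last a (a :: w)).
have cA : path_set A c.
  move=> n; have [nw|wn] := ltnP n (size w).
    rewrite /c /= !ltnS ltnW // nw.
    by have /pathP -/(_ a n nw) := Aw.
  rewrite !cS ?leqW // subSn // iterS; exact: xchooseP (primitive_succ hA _).
exists (exist _ c (mem_set cA)); apply/cylP => i iw.
by rewrite /coord /= /c iw; exact: set_nth_default.
Qed.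

Lemma nbhs_pathP (x : X) (U : set X) : nbhs x U ->
  exists n, cyl (initial_word x n) `<=` U.
Proof.
move=> [_ [[W oW <-] Wx sWU]].
have [n nW] := nbhs_prodP (open_nbhs_nbhs (conj oW Wx)).
exists n => y /cyl_initial_word /initial_wordP yx; apply: sWU.
by apply: nW => i /yx.
Qed.

Lemma coord_continuous n : continuous (fun x : X => coord x n : discN).
Proof.
move=> x; apply: (@continuous_comp X P discN (fun x => set_val x) (fun f => f n)).
  exact: initial_continuous.
exact: (@proj_continuous _ (fun _ : nat => discN) n).
Qed.

Lemma nbhs_initial_word (x : X) n :
  nbhs x [set y | initial_word y n = initial_word x n].
Proof.
elim: n => [|n IH]; first exact: filterS filterT.
have cn : nbhs x [set y | coord y n = coord x n].
  by apply: (@coord_continuous n x [set a | a = coord x n]); apply/principal_filterP.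
apply: filterS2 IH cn => y /= e1 e2; by rewrite !initial_wordS e1 e2.
Qed.

Lemma cyl_open (w : word N) : open (@cyl _ _ hA w).
Proof.
rewrite openE => x xw; rewrite /interior.
by apply: filterS (nbhs_initial_word x (size w)) => y /= e; rewrite /cyl /= e.
Qed.

End PathTopology.

(** Transports an ultrafilter from a part of the groupoid to a compact product space. A strictly
    finer filter would contain a set together with its complement. *)
Lemma fmap_ultra (T U : Type) (f : T -> U) (F : set_system T) :
  UltraFilter F -> UltraFilter (f @ F).
Proof.
move=> FU; split => [|K KF FK]; first exact: fmap_proper_filter.
apply/seteqP; split => // B KB; have [//|FB] := in_ultra_setVsetC (f @^-1` B) FU.
have := filter_ex (filterI KB (FK (~` B) FB)).
by case=> z [].
Qed.

(** * The parts of the groupoid: source map, neighbourhoods, compactness *)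

Section GroupoidTopology.
Variables (N : nat) (A : 'M[bool]_N.+1) (hA : primitive A).
Local Notation X := (path_space hA).
Local Notation G := (groupoid hA).
Local Notation sh := (@shift _ _ hA).
Implicit Types (gam : word N * word N) (g : G).

Lemma kappaP g : lag (rng g) (coc g) (src g) (kappa g) /\
  forall k, lag (rng g) (coc g) (src g) k -> (kappa g <= k)%N.
Proof.
rewrite /kappa; case: ex_minnP => m /asboolP hm min; split => // k hk.
by apply: min; apply/asboolP.
Qed.

(** The word lengths are [kappa g + 1] and [coc g + kappa g], so on a part they determine both
    integers. *)
Lemma GpartE gam g : Gpart gam g ->
  [/\ kappa g = (size gam.2).-1, coc g = (size gam.1)%:Z - (size gam.2).-1%:Z,
      initial_word (rng g) (size gam.1) = gam.1 &
      initial_word (src g) (size gam.2) = gam.2].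
Proof.
move=> [r s]; have [[c0 _] _] := kappaP g.
have e1 : size gam.2 = (kappa g).+1 by rewrite -s size_initial_word.
have e2 : size gam.1 = absz (coc g + (kappa g)%:Z) by rewrite -r size_initial_word.
have e3 : coc g = (size gam.1)%:Z - (kappa g)%:Z by rewrite e2 gez0_abs // addrK.
split; [by rewrite e1|by rewrite e1|by rewrite e2|by rewrite e1].
Qed.

Lemma GpartP gam g : gam.2 != [::] ->
  Gpart gam g <->
  [/\ kappa g = (size gam.2).-1, coc g = (size gam.1)%:Z - (size gam.2).-1%:Z,
      initial_word (rng g) (size gam.1) = gam.1 &
      initial_word (src g) (size gam.2) = gam.2].
Proof.
move=> b0; split; first exact: GpartE.
move=> [k c r s]; rewrite /Gpart /= /ell_r /ell_s c k subrK /=; split => //.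
by rewrite prednK // lt0n size_eq0.
Qed.

Lemma Gpart_lag gam g : Gpart gam g ->
  iter (size gam.1) sh (rng g) = iter (size gam.2).-1 sh (src g).
Proof.
move=> gg; have [k c _ _] := GpartE gg; have [[_]] := kappaP g.
by rewrite c k subrK.
Qed.

(** Together with the fixed prefix [gam.1], this makes the range a function of the source on each
    part, so the source alone controls the topology there. *)
Lemma Gpart_rng_coord gam g i : Gpart gam g -> coord (rng g) (i + size gam.1) =
  coord (src g) (i + (size gam.2).-1).
Proof. by move=> gg; rewrite -!coord_shift (Gpart_lag gg). Qed.

Lemma Gpart_disj gam gam' g : Gpart gam g -> Gpart gam' g -> gam = gam'.
Proof. by case: gam gam' => [a b] [a' b'] [/= <- <-] [/= <- <-]. Qed.

Lemma Gpart_src gam g : Gpart gam g -> cyl gam.2 (src g).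
Proof. by move=> /GpartE[]. Qed.

Lemma Gpart_ell g : Gpart (ell_r g, ell_s g) g. Proof. by []. Qed.

(* Minimality of [kappa g] gives the last clause in the definition of [IA]. *)
Lemma IA_ell g : IA A (ell_r g, ell_s g).
Proof.
have adA : admissible A (ell_r g) by exact: admissible_initial_word.
have adB : admissible A (ell_s g) by exact: admissible_initial_word.
have gg := Gpart_ell g; have [k c r s] := GpartE gg.
have [[c0 lg] min] := kappaP g.
move: adA adB gg k c r s; set al := ell_r g; set be := ell_s g => adA adB gg _ c _ _.
have sb : size be = (kappa g).+1 by rewrite size_initial_word.
have sa : size al = absz (coc g + (kappa g)%:Z) by rewrite size_initial_word.
have lb i : (i <= kappa g)%N -> nth ord0 be i = coord (src g) i.
  by move=> ik; rewrite nth_initial_word.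
have la i : (i < size al)%N -> nth ord0 al i = coord (rng g) i.
  by rewrite sa => ik; rewrite nth_initial_word.
have gc i : coord (rng g) (i + size al) = coord (src g) (i + kappa g).
  by have := Gpart_rng_coord i gg; rewrite -[(al, be).2]/be sb.
rewrite -[(al, be).1]/al -[(al, be).2]/be in c *.
clearbody al be.
split => //=.
- by rewrite -size_eq0 sb.
- have [->|al0] := eqVneq al [::]; [by left|right].
  have sa0 : (0 < size al)%N by rewrite lt0n size_eq0.
  have := coord_adm (rng g) (size al).-1; rewrite prednK //.
  by have := gc 0%N; rewrite !add0n /letter sb /= lb // => ->; rewrite la // prednK.
- have [->|al0] := eqVneq al [::]; [by constructor 1|].
  have [k0|k0] := eqVneq (kappa g) 0%N; [by rewrite sb k0; constructor 2|constructor 3].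
  have sa0 : (0 < size al)%N by rewrite lt0n size_eq0.
  apply/eqP => e.
  case mE : (kappa g) k0 => [//|m] _; case pE : (size al) sa0 => [//|p] _.
  have cm : coc g + m%:Z = p%:Z by rewrite c sb pE mE /=; lia.
  suff /min : lag (rng g) (coc g) (src g) m by rewrite mE ltnn.
  split; rewrite cm //=; apply: coord_inj => -[|n]; rewrite !coord_shift ?add0n.
    by move: e; rewrite /letter sb mE /= pE /= la ?lb ?mE ?pE.
  by have := gc n; rewrite pE mE !addnS -!addSn.
Qed.

Definition Zpart gam (w : word N) : set G := Gpart gam `&` (@src _ _ hA @^-1` cyl w).

Lemma Zpart_Gpart gam : gam.2 != [::] -> Zpart gam gam.2 = Gpart gam.
Proof.
move=> b0; apply/seteqP; split=> [g []//|g gg]; split => //; exact: Gpart_src gg.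
Qed.

Lemma src_surj gam (y : X) : IA A gam -> cyl gam.2 y ->
  exists2 g : G, Gpart gam g & src g = y.
Proof.
case: gam => al be [/= Aal Abe be0 link minl] yb.
set m := (size be).-1.
have mE : size be = m.+1 by rewrite prednK // lt0n size_eq0.
(* The arrow sought is (x, |alpha| - m, y), with [x] equal to alpha followed by the [m]-th shift of
   [y]. The link condition of [IA] gives admissibility at the junction. *)
pose c n := if (n < size al)%N then nth ord0 al n else coord y (n - size al + m).
have cA : path_set A c.
  move=> n; rewrite /c; case: (ltnP n.+1 (size al)) => [n1|n1].
    rewrite ltnW //; case: al Aal n1 {link minl c} => // a al.
    by move=> /(pathP ord0) h /= n1; exact: h.
  case: ltnP => n2.
    have e : size al = n.+1 by apply/eqP; rewrite eqn_leq n1.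
    rewrite e subnn add0n; case: link => [al0|]; first by rewrite al0 in e.
    by rewrite /letter mE e /= -((cylP _ _).1 yb) // mE.
  by rewrite subSn // addSn; exact: coord_adm.
pose x : X := exist _ c (mem_set cA).
have cx n : coord x n = c n by [].
(* A smaller lag [k], read at coordinate [m - k - 1], would identify the last letter of alpha with
   the last but one letter of beta. The last clause of [IA] forbids this, so [kappa] is exactly
   [m]. *)
have xy k : (k <= m)%N -> (m <= size al + k)%N ->
   iter (size al + k - m) sh x = iter k sh y -> k = m.
  move=> km mk e; apply/eqP; rewrite eqn_leq km leqNgt; apply/negP => ltkm.
  have := congr1 (fun z : X => coord z (m - k.+1)%N) e; rewrite /= !coord_shift cx /c.
  have i1 : (m - k.+1 + (size al + k - m) = (size al).-1)%N by lia.
  have i2 : (m - k.+1 + k = m.-1)%N by lia.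
  rewrite i1 i2.
  have sa0 : (0 < size al)%N by lia.
  rewrite prednK // leqnn => e'.
  case: minl => [al0|be1|/eqP]; [by rewrite al0 in sa0|lia|apply].
  by rewrite /letter mE /= e' ((cylP _ _).1 yb) // mE; lia.
pose n : int := (size al)%:Z - m%:Z.
have lagm : lag x n y m.
  split; rewrite /n subrK //=; apply: coord_inj => k; rewrite !coord_shift cx /c.
  by rewrite ltnNge leq_addl /= addnK.
pose g : G := exist _ (x, n, y) (mem_set (ex_intro _ m lagm)).
exists g => //; apply/GpartP => //=.
have kg : kappa g = m.
  have [[g1 g2] min] := kappaP g.
  have km := min m lagm.
  have cg : coc g = (size al)%:Z - m%:Z by [].
  rewrite cg in g1 g2.
  move: (kappa g) km g1 g2 => k km g1 g2; clear -xy km g1 g2.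
  apply: xy => //; first by lia.
  by rewrite -g2; congr (iter _ _ _); lia.
split => //.
by apply: (@eq_from_nth _ ord0); rewrite size_initial_word // => i ia;
  rewrite nth_initial_word // cx /c ia.
Qed.

Lemma Zpart_src gam (w : word N) : IA A gam -> prefix gam.2 w ->
  @src _ _ hA @` Zpart gam w = cyl w.
Proof.
move=> gI pw; apply/seteqP; split=> [y [g [_ gw] <-]//|y yw].
have [g gg e] := src_surj gI (cyl_prefix pw yw).
by exists g => //; split => //=; rewrite e.
Qed.

Lemma groupoid_coords_continuous : continuous (@groupoid_coords _ _ hA).
Proof. exact: initial_continuous. Qed.

Lemma src_continuous : continuous (@src _ _ hA).
Proof.
move=> g; apply: (continuous_comp (f := @groupoid_coords _ _ hA)
   (g := fun p : X * X * nat * discrete_topology int => p.1.1.1)).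
  exact: groupoid_coords_continuous.
apply: (continuous_comp (g := fst)); last exact: cvg_fst.
by apply: (continuous_comp (g := fst)); exact: cvg_fst.
Qed.

Lemma rng_continuous : continuous (@rng _ _ hA).
Proof.
move=> g; apply: (continuous_comp (f := @groupoid_coords _ _ hA)
   (g := fun p : X * X * nat * discrete_topology int => p.1.1.2)).
  exact: groupoid_coords_continuous.
apply: (continuous_comp (g := snd)); last exact: cvg_snd.
by apply: (continuous_comp (g := fst)); exact: cvg_fst.
Qed.

Lemma nbhs_kappa g : nbhs g [set g' | kappa g' = kappa g].
Proof.
have c : {for g, continuous (@kappa _ _ hA)}.
  apply: (continuous_comp (f := @groupoid_coords _ _ hA)
   (g := fun p : X * X * nat * discrete_topology int => p.1.2)).
    exact: groupoid_coords_continuous.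
  apply: (continuous_comp (g := snd)); last exact: cvg_snd.
  exact: cvg_fst.
by apply: (c [set k | k = kappa g]); apply/principal_filterP.
Qed.

Lemma nbhs_coc g : nbhs g [set g' | coc g' = coc g].
Proof.
have c : {for g, continuous (@coc _ _ hA : G -> discrete_topology int)}.
  apply: (continuous_comp (f := @groupoid_coords _ _ hA)
   (g := fun p : X * X * nat * discrete_topology int => p.2)).
    exact: groupoid_coords_continuous.
  exact: cvg_snd.
by apply: (c [set k | k = coc g]); apply/principal_filterP.
Qed.

(** [kappa] and [coc] take discrete values, so the lengths of the two words are locally constant;
    continuity of [src] and [rng] then fixes the letters. *)
Lemma nbhs_ell g : nbhs g [set g' | ell_r g' = ell_r g /\ ell_s g' = ell_s g].
Proof.
have n1 : nbhs g [set g' | initial_word (src g') (kappa g).+1 =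
    initial_word (src g) (kappa g).+1].
  exact: src_continuous (nbhs_initial_word _ _).
have n2 : nbhs g [set g' | initial_word (rng g') (absz (coc g + (kappa g)%:Z)) =
    initial_word (rng g) (absz (coc g + (kappa g)%:Z))].
  exact: rng_continuous (nbhs_initial_word _ _).
apply: filterS2 (filterI n1 n2) (filterI (nbhs_kappa g) (nbhs_coc g)).
by move=> g' [/= e1 e2] [/= e3 e4]; rewrite /ell_r /ell_s e3 e4.
Qed.

Lemma Gpart_open gam : open (Gpart gam : set G).
Proof.
rewrite openE => g [r s]; rewrite /interior.
by apply: filterS (nbhs_ell g) => g' [r' s']; rewrite /Gpart /= r' s'.
Qed.

Lemma Gpart_closed gam : closed (Gpart gam : set G).
Proof.
move=> g /(_ _ (nbhs_ell g)) [g' [[r s] [e1 e2]]].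
by rewrite /Gpart /= -e1 -e2.
Qed.

Lemma Zpart_open gam (w : word N) : open (Zpart gam w).
Proof.
apply: openI; first exact: Gpart_open.
by have /continuousP := src_continuous; apply; exact: cyl_open.
Qed.

Lemma nbhs_Zpart gam g (U : set G) : gam.2 != [::] -> Gpart gam g -> nbhs g U ->
  exists2 n, (size gam.2 <= n)%N & Zpart gam (initial_word (src g) n) `<=` U.
Proof.
move=> b0 gg [_ [[W oW <-] Wg sWU]].
have := open_nbhs_nbhs (conj oW Wg).
move=> [[V1 V2] [/= [[V3 V4] [/= [[V5 V6] [/= n5 n6] n56] n4] n34] n2] n12].
have [n1 h1] := nbhs_pathP n5; have [m h2] := nbhs_pathP n6.
(* The first [m] letters of the range are letters of [gam.1] or letters of the source at positions
   below [m + size gam.2], so agreement of the sources to that depth controls the range as well. *)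
exists (maxn (size gam.2) (maxn n1 (m + (size gam.2)))); first exact: leq_maxl.
move=> g' [g'g] /= /cyl_initial_word s'; apply: sWU => /=.
have [k c r s] := GpartE gg; have [k' c' r' _] := GpartE g'g.
apply: n12; split => /=; last first.
  by rewrite c' -c; exact: nbhs_singleton n2.
apply: n34; split => /=; last first.
  by rewrite k' -k; exact: nbhs_singleton n4.
apply: n56; split => /=.
  apply/h1/cyl_initial_word; apply: initial_word_le s'.
  by rewrite !leq_max leqnn orbT.
apply/h2/cyl_initial_word/initial_wordP => i im.
have [ia|ia] := ltnP i (size gam.1).
  by have /initial_wordP := etrans r' (esym r); apply.
rewrite -(subnK ia) (Gpart_rng_coord _ gg) (Gpart_rng_coord _ g'g).
have /initial_wordP := s'; apply.
rewrite !leq_max; apply/orP; right; apply/orP; right.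
by have : size gam.2 != 0%N; [rewrite size_eq0|lia].
Qed.

(** The source map pushes an ultrafilter to the space of all sequences, compact by Tychonoff. Its
    limit is admissible because each transition involves two coordinates only; it lifts to the part
    by [src_surj], and [nbhs_Zpart] gives convergence to the lift. *)
Lemma Gpart_compact gam : IA A gam -> compact (Gpart gam : set G).
Proof.
move=> gI; have [_ _ b0 _ _] := gI.
rewrite compact_ultra => F FU FG.
pose pi (g : G) : prod_topology (fun _ : nat => discrete_topology 'I_N.+1) :=
  sval (src g).
have fin : finite_set [set: discrete_topology 'I_N.+1].
  exact: (@finite_finset 'I_N.+1 setT).
have := @tychonoff nat (fun _ => discrete_topology 'I_N.+1) (fun=> setT)
  (fun _ => finite_compact fin).
rewrite compact_ultra => /(_ (pi @ F)) [||p [_ Fp]].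
- exact: fmap_ultra.
- by apply: (@filterS _ F _ (Gpart gam)).
have Fi n : F [set g : G | forall i, (i < n)%N -> coord (src g) i = p i].
  elim: n => [|n IH]; first by apply: filterS FG.
  have np : nbhs p [set q : prod_topology (fun _ : nat => discrete_topology 'I_N.+1) |
      q n = p n].
    apply: (@proj_continuous _ (fun _ : nat => discrete_topology 'I_N.+1) n p
      [set a | a = p n]).
    by apply/principal_filterP.
  have Fn : F [set g : G | coord (src g) n = p n] := Fp _ np.
  apply: filterS2 IH Fn => g h1 h2 i; rewrite ltnS leq_eqVlt => /orP[/eqP ->|] //.
  exact: h1.
have pA : path_set A p.
  move=> n; have [g gp] := filter_ex (Fi n.+2).
  by rewrite -!gp //; exact: coord_adm.
pose y : X := exist _ p (mem_set pA).
have Fy n : F [set g : G | initial_word (src g) n = initial_word y n].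
  by apply: filterS (Fi n) => g gp; apply/initial_wordP.
have yb : cyl gam.2 y.
  have [g [gg gy]] := filter_ex (filterI FG (Fy (size gam.2))).
  by rewrite /cyl /= -gy; exact: Gpart_src gg.
have [g gg gy] := src_surj gI yb.
exists g; split => // U /(nbhs_Zpart b0 gg) [n _ sU].
suff FZ : F (Zpart gam (initial_word (src g) n)) by exact: filterS FZ.
apply: filterS2 FG (Fy n) => g' g'g e; split => //=.
by apply/cyl_initial_word; rewrite gy.
Qed.
End GroupoidTopology.

(** * Locally constant functions on the parts of the groupoid *)

Section Lifting.
Context {R : realType} {N : nat} {A : 'M[bool]_N.+1} {hA : primitive A}.
Local Notation X := (path_space hA).
Local Notation G := (groupoid hA).
Variable mu : {measure set (borel X) -> \bar R}.
Variable muG : {measure set (borel G) -> \bar R}.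
Hypothesis hmuG : groupoid_measure mu muG.
Hypothesis mu_fin : forall w : word N, w != [::] -> (mu (cyl w) < +oo)%E.
Implicit Types (phi psi : X -> R[i]) (gam : word N * word N) (bet w : word N).

Lemma measurable_open_borel (T : ptopologicalType) (U : set T) :
  open U -> measurable (U : set (borel T)).
Proof. by move=> oU; exact: sub_gen_smallest. Qed.

Lemma measurable_cyl w : measurable (cyl w : set (borel X)).
Proof. by apply: measurable_open_borel; exact: cyl_open. Qed.

Lemma measurable_Gpart gam : measurable (Gpart gam : set (borel G)).
Proof. by apply: measurable_open_borel; exact: Gpart_open. Qed.

Lemma measurable_Zpart gam w : measurable (Zpart gam w : set (borel G)).
Proof. by apply: measurable_open_borel; exact: Zpart_open. Qed.

Lemma muG_Zpart gam w : IA A gam -> prefix gam.2 w ->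
  muG (Zpart gam w) = mu (cyl w).
Proof.
move=> gI pw; rewrite (hmuG gI (measurable_Zpart _ _)) ?Zpart_src //.
by move=> g [].
Qed.

(** The locally constant functions for which integration over a part reduces to finitely many
    cylinder measures. *)
Definition deep bet n phi :=
  (forall x y, initial_word x n = initial_word y n -> phi x = phi y) /\
  (forall x, ~ cyl bet x -> phi x = 0).

Lemma deep_le bet m n phi : (m <= n)%N -> deep bet m phi -> deep bet n phi.
Proof.
by move=> mn [h1 h2]; split => // x y /(initial_word_le mn); exact: h1.
Qed.

Lemma deepM bet n phi psi : deep bet n phi -> deep bet n psi ->
  deep bet n (fun x => phi x * (psi x)^*%C).
Proof.
move=> [h1 h2] [k1 k2]; split=> [x y e|x xb]; first by rewrite (h1 _ _ e) (k1 _ _ e).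
by rewrite h2 // mul0r.
Qed.

Lemma deep_indic bet w : prefix bet w -> deep bet (size w) \1_(cyl w).
Proof.
move=> pw; split=> [x y e|x xb].
  by rewrite !indicE; congr (_%:R); congr nat_of_bool; apply/idP/idP => /set_mem xw;
    apply/mem_set; move: xw; rewrite /cyl /= e.
by rewrite indicE memNset // => /(cyl_prefix pw).
Qed.

Definition glift gam phi (g : G) : R[i] := \1_(Gpart gam) g * phi (src g).

Lemma gliftE gam phi g : Gpart gam g -> glift gam phi g = phi (src g).
Proof. by move=> gg; rewrite /glift indicE mem_set // mul1r. Qed.

Lemma glift0 gam phi g : ~ Gpart gam g -> glift gam phi g = 0.
Proof. by move=> gg; rewrite /glift indicE memNset // mul0r. Qed.

Lemma glift_indic gam w : glift gam \1_(cyl w) = \1_(Zpart gam w).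
Proof.
apply/funext => g; rewrite /glift -[RHS]/(\1_(Gpart gam `&` _) g) indicI /=.
by [].
Qed.

(** For an inadmissible word [get] returns a default point. This is harmless, because [coef] only
    occurs multiplied by the indicator of the then empty cylinder. *)
Definition coef phi w : R[i] := phi (get (@cyl _ _ hA w)).

(** Cylinders of words of length [n] are disjoint, so only the initial word of [x] can contribute;
    if it does not extend [bet], both sides are 0. *)
Lemma deep_sum bet n phi x : deep bet n phi -> (size bet <= n)%N ->
  phi x = \sum_(w : n.-tuple 'I_N.+1 | prefix bet w) coef phi w * \1_(cyl w) x.
Proof.
move=> [h1 h2] bn.
have sz : size (initial_word x n) == n by rewrite size_initial_word.
pose w0 := Tuple sz.
have cw0 : cyl w0 x by rewrite /cyl /= size_initial_word.
have cg : cyl w0 (get (@cyl _ _ hA w0)).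
  exact: (@getPex _ (@cyl _ _ hA w0)) (ex_intro _ x cw0).
have ev (w : n.-tuple 'I_N.+1) : cyl (tval w) x -> w = w0.
  by rewrite /cyl /= size_tuple => e; apply: val_inj; rewrite /= e.
have [pw|pw] := boolP (prefix bet w0).
  rewrite (bigD1 w0) //= indicE mem_set // mulr1 big1 ?addr0.
    apply: h1; symmetry; move: cg; rewrite /cyl /= size_initial_word.
    by move=> ->.
  move=> w /andP[_ ww0]; rewrite indicE memNset ?mulr0 // => /ev e.
  by rewrite e eqxx in ww0.
rewrite h2; last first.
  move=> xb; move/negP: pw; apply; rewrite /= prefixE take_initial_word //.
  by apply/eqP.
rewrite big1 // => w pw'; rewrite indicE memNset ?mulr0 // => /ev e.
by rewrite -e pw' in pw.
Qed.

Lemma glift_sum gam n phi g : deep gam.2 n phi -> (size gam.2 <= n)%N ->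
  glift gam phi g =
  \sum_(w : n.-tuple 'I_N.+1 | prefix gam.2 w) coef phi w * \1_(Zpart gam w) g.
Proof.
move=> dp bn; rewrite {1}/glift (deep_sum _ dp bn) mulr_sumr.
by apply: eq_bigr => w _; rewrite mulrCA -glift_indic.
Qed.

Lemma nonempty_prefix bet w : bet != [::] -> prefix bet w -> w != [::].
Proof. by case: w => //; rewrite prefixs0 => /negbTE ->. Qed.

Section DeepFunctions.
Variables (gam : word N * word N) (n : nat) (phi : X -> R[i]).
Hypotheses (gI : IA A gam) (dp : deep gam.2 n phi).

(** The depth is raised to at least [size gam.2], because the expansion runs over words extending
    [gam.2]. *)
Let m := maxn n (size gam.2).
Let dm : deep gam.2 m phi. Proof. by apply: deep_le dp; exact: leq_maxl. Qed.
Let bm : (size gam.2 <= m)%N. Proof. exact: leq_maxr. Qed.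
Let b0 : gam.2 != [::]. Proof. by case: gI. Qed.

(** The condition on [w] is moved into the summand to fit the unrestricted sums of [cintegral_sum]
    and [L2_sum]. *)
Let phiE : phi = fun x => \sum_(w : m.-tuple 'I_N.+1)
  (if prefix gam.2 w then coef phi w * \1_(cyl w) x else 0).
Proof. by apply/funext => x; rewrite (deep_sum x dm bm) big_mkcond. Qed.

Let lphiE : glift gam phi = fun g => \sum_(w : m.-tuple 'I_N.+1)
  (if prefix gam.2 w then coef phi w * \1_(Zpart gam w) g else 0).
Proof. by apply/funext => g; rewrite (glift_sum g dm bm) big_mkcond. Qed.

Let i1 (w : m.-tuple 'I_N.+1) : cintegrable mu (fun x : X =>
   (if prefix gam.2 w then coef phi w * \1_(cyl w) x else 0)).
Proof.
case pw : (prefix gam.2 w); last exact: cintegrable0.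
apply: cintegrableZ; apply: cintegrable_indic; first exact: measurable_cyl.
by apply: mu_fin; exact: nonempty_prefix pw.
Qed.

Let i2 (w : m.-tuple 'I_N.+1) : cintegrable muG (fun g : G =>
   (if prefix gam.2 w then coef phi w * \1_(Zpart gam w) g else 0)).
Proof.
case pw : (prefix gam.2 w); last exact: cintegrable0.
apply: cintegrableZ; apply: cintegrable_indic; first exact: measurable_Zpart.
by rewrite muG_Zpart //; apply: mu_fin; exact: nonempty_prefix pw.
Qed.

Lemma deep_cintegrable : cintegrable mu phi.
Proof. by rewrite phiE; exact: (cintegrable_sum _ i1). Qed.

(** Change of variables along the source map: both sides are the same finite combination, by
    [muG_Zpart]. *)
Lemma glift_cintegral : cintegral muG (glift gam phi) = cintegral mu phi.
Proof.
rewrite lphiE [in RHS]phiE !cintegral_sum //; apply: eq_bigr => w _.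
case pw : (prefix gam.2 w); last by rewrite !cintegral0.
have w0 := nonempty_prefix b0 pw.
rewrite !cintegralZ ?cintegral_indic ?muG_Zpart //.
- exact: measurable_cyl.
- exact: measurable_Zpart.
- by apply: cintegrable_indic; [exact: measurable_cyl|exact: mu_fin].
- apply: cintegrable_indic; first exact: measurable_Zpart.
  by rewrite muG_Zpart //; exact: mu_fin.
Qed.

Lemma glift_L2 : L2 muG (glift gam phi).
Proof.
rewrite lphiE; apply: L2_sum => w; case pw : (prefix gam.2 w); last exact: L2_0.
apply: L2Z; apply: L2_indic; first exact: measurable_Zpart.
by rewrite muG_Zpart //; apply: mu_fin; exact: nonempty_prefix pw.
Qed.

(** A part is open, closed and compact: local constancy is checked separately on it and on its
    complement, and the closure of the support stays inside it. *)
Lemma glift_Ccinfty : @Ccinfty R G (glift gam phi).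
Proof.
split.
  move=> g; have [gg|ng] := pselect (Gpart gam g).
    have n1 : nbhs g (Gpart gam) by apply: open_nbhs_nbhs; split => //; exact: Gpart_open.
    have n2 : nbhs g [set g' | initial_word (src g') n = initial_word (src g) n].
      exact: src_continuous (nbhs_initial_word _ _).
    apply: filterS2 n1 n2 => g' g'g e; rewrite !gliftE //; exact: dp.1.
  have n1 : nbhs g (~` Gpart gam).
    by apply: open_nbhs_nbhs; split => //; apply: closed_openC; exact: Gpart_closed.
  by apply: filterS n1 => g' g'g; rewrite !glift0.
apply: (subclosed_compact _ (Gpart_compact gI : compact (Gpart gam : set G))).
  exact: closed_closure.
rewrite [X in _ `<=` X](closure_id (Gpart gam : set G)).1; last exact: Gpart_closed.
apply: closure_subset => g /= /eqP lg; apply: contrapT => gg.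
by rewrite glift0 in lg.
Qed.
End DeepFunctions.

Lemma glift_cdot_neq gam gam' phi psi : gam != gam' ->
  cdot muG (glift gam phi) (glift gam' psi) = 0.
Proof.
move=> gg'; rewrite /cdot -[RHS](cintegral0 muG); apply: eq_cintegral => g.
have [h|h] := pselect (Gpart gam g); last by rewrite glift0 // mul0r.
have [h'|h'] := pselect (Gpart gam' g); last by rewrite (glift0 _ h') rmorph0 mulr0.
by rewrite (Gpart_disj h h') eqxx in gg'.
Qed.

Lemma glift_cdot gam n phi psi : IA A gam -> deep gam.2 n phi -> deep gam.2 n psi ->
  cdot muG (glift gam phi) (glift gam psi) = cdot mu phi psi.
Proof.
move=> gI dphi dpsi; rewrite /cdot -(glift_cintegral gI (deepM dphi dpsi)).
apply: eq_cintegral => g.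
have [h|h] := pselect (Gpart gam g); last by rewrite !glift0 // mul0r.
by rewrite !gliftE.
Qed.

End Lifting.

(** * The logarithmic Dirichlet Laplacian *)

Section Kernel.
Context {R : realType} {N : nat} {A : 'M[bool]_N.+1} {hA : primitive A}.
Local Notation X := (path_space hA).
Local Notation G := (groupoid hA).
Variables (lam lmax : R).
Hypotheses (hlam : 1 < lam) (hlmax1 : 1 < lmax).

Definition path_kernel (x y : X) : R := (path_dist lam x y `^ delta lam lmax)^-1.

(** The exponent [delta] is the logarithm of [lmax] in base [lam], which is exactly what converts
    the distance [lam ^- m] into [lmax ^+ m]. *)
Lemma path_kernelE (x y : X) m : initial_word x m = initial_word y m ->
  coord x m != coord y m -> path_kernel x y = lmax ^+ m.
Proof.
move=> /initial_wordP e ne; rewrite /path_kernel /path_dist.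
case: pselect => [h|[]]; last by exists m.
case: ex_minnP => k nek mink.
have -> : k = m.
  apply/eqP; rewrite eqn_leq mink //= leqNgt; apply/negP => km.
  by move: nek; rewrite e // eqxx.
have lam0 : 0 < lam by exact: lt_trans hlam.
have lmax0 : 0 < lmax by exact: lt_trans hlmax1.
have lnlam : ln lam != 0 by rewrite gt_eqF // ln_gt0.
rewrite /powR invr_eq0 expf_eq0 gt_eqF // andbF.
rewrite lnV ?posrE ?exprn_gt0 // lnXn // /delta -mulNrn mulrnAr mulrN divfK //.
by rewrite mulNrn expRN -mulr_natl expRM_natl lnK ?posrE // invrK.
Qed.

Lemma kernel_eq gam (g1 g2 : G) : Gpart gam g1 -> Gpart gam g2 ->
  kernel lam lmax g1 g2 = path_kernel (src g1) (src g2).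
Proof.
by move=> [r1 s1] [r2 s2]; rewrite /kernel /groupoid_dist r1 s1 r2 s2 !eqxx.
Qed.

Lemma kernel_neq gam (g1 g2 : G) : Gpart gam g1 -> ~ Gpart gam g2 ->
  kernel lam lmax g1 g2 = 0.
Proof.
move=> [r1 s1] n2; rewrite /kernel /groupoid_dist; case: ifP => // /andP[/eqP r /eqP s].
by case: n2; rewrite /Gpart /= -r -s.
Qed.

(* [m] is the length of the longest common prefix of [x] and [y]. *)
Lemma first_difference (x y : X) : x = y \/
  exists m, [/\ initial_word x m = initial_word y m, coord x m != coord y m &
    forall k, initial_word y k = initial_word x k <-> (k <= m)%N].
Proof.
have [h|h] := pselect (exists n, coord x n != coord y n); [right|left]; last first.
  by apply: coord_inj => n; apply/eqP; apply: contrapT => /negP ne; apply: h; exists n.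
case: (ex_minnP h) => m ne minm; exists m.
have e i : (i < m)%N -> coord x i = coord y i.
  by move=> im; apply/eqP; apply: contraTT im => /minm; rewrite leqNgt.
split=> // [|k]; first exact/initial_wordP.
split=> [/initial_wordP ek|km].
  by rewrite leqNgt; apply/negP => mk; rewrite ek // eqxx in ne.
by apply/initial_wordP => i ik; rewrite e //; exact: leq_trans ik km.
Qed.
End Kernel.

(** * The eigenvalue equation for a mean-zero function supported in one cylinder *)

Section LaplacianEigen.
Context {R : realType} {N : nat} {A : 'M[bool]_N.+1} {hA : primitive A}.
Local Notation X := (path_space hA).
Local Notation G := (groupoid hA).
Variables (lam lmax : R) (u v : 'cV[R]_N.+1).
Hypotheses (hlam : 1 < lam) (hlmax1 : 1 < lmax) (huv : PF_eigenvectors A lmax u v).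
Variable mu : {measure set (borel X) -> \bar R}.
Hypothesis hmu : parry_measure lmax u v mu.
Variable muG : {measure set (borel G) -> \bar R}.
Hypothesis hmuG : groupoid_measure mu muG.

Let u0 i : 0 < u i 0. Proof. by case: huv => h _ _ _; case: (h i). Qed.
Let v0 i : 0 < v i 0. Proof. by case: huv => h _ _ _; case: (h i). Qed.
Let lmax0 : 0 < lmax. Proof. exact: lt_trans hlmax1. Qed.

(** [parry_measure] speaks of admissible words only; the cylinder of an inadmissible word is
    empty. *)
Lemma parry_fin (w : word N) : w != [::] -> (mu (cyl w) < +oo)%E.
Proof.
move=> w0; have [Aw|nA] := boolP (admissible A w); first by rewrite hmu // ltry.
rewrite (_ : cyl w = set0) ?measure0 //.
by rewrite -subset0 => x /cyl_admissible; rewrite (negbTE nA).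
Qed.

Lemma parry_gt0 (w : word N) : admissible A w -> w != [::] ->
  0 < fine (mu (cyl w)).
Proof.
move=> Aw w0; rewrite hmu //= !mulr_gt0 ?invr_gt0 ?exprn_gt0 //.
Qed.

Lemma parry_initial_word (x : X) m : fine (mu (cyl (initial_word x m.+1))) =
  v (coord x 0) 0 * u (coord x m) 0 * lmax ^- m.
Proof.
set w := initial_word x m.+1.
have sz : size w = m.+1 := size_initial_word x m.+1.
have -> : fine (mu (cyl w)) =
    v (letter w 1) 0 * u (letter w (size w)) 0 * lmax ^- (size w).-1.
  by rewrite hmu ?admissible_initial_word // -size_eq0 sz.
by rewrite /letter sz !nth_initial_word.
Qed.

Variables (gam : word N * word N) (nu : word N) (h : X -> R[i]).
Hypotheses (gI : IA A gam) (pnu : prefix gam.2 nu).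
Hypothesis dh : deep gam.2 (size nu).+1 h.
Hypothesis hnu : forall x, ~ cyl nu x -> h x = 0.
Hypothesis h0 : cintegral mu h = 0.

Let n := size nu.
Let b := size gam.2.
Let bn : (b <= n)%N. Proof. exact: size_prefix. Qed.
Let b0 : (0 < b)%N. Proof. by case: gI => _ _ + _ _; rewrite lt0n size_eq0. Qed.
Let ih : cintegrable mu h.
Proof. exact (deep_cintegrable parry_fin gI dh). Qed.

Definition shell (x : X) m : X -> R[i] :=
  fun y => \1_(cyl (initial_word x m)) y - \1_(cyl (initial_word x m.+1)) y.

(* The index [k] of [lambdaA] corresponds to the shell of level [m = n - k - 1]. *)
Definition expansion (x : X) : X -> R[i] := fun y =>
  \sum_(k < n - b) h x * (lmax ^+ (n - k - 1))%:C * shell x (n - k - 1) y +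
  (lmax ^+ n)%:C * (h x * \1_(cyl nu) y - h y).

Lemma indic_initial_word (x y : X) m k :
  (forall k, initial_word y k = initial_word x k <-> (k <= m)%N) ->
  \1_(cyl (initial_word x k)) y = (k <= m)%N%:R :> R[i].
Proof.
move=> e; rewrite indicE; congr (_%:R); congr nat_of_bool; apply/idP/idP.
  by move=> /set_mem /cyl_initial_word /e.
by move=> /e km; apply/mem_set/cyl_initial_word.
Qed.

Lemma expansionE (x y : X) : cyl nu x -> cyl gam.2 y ->
  (h x - h y) * (path_kernel lam lmax x y)%:C = expansion x y.
Proof.
move=> xnu yb; have xE : initial_word x n = nu by [].
have nuE : \1_(cyl nu) y = \1_(cyl (initial_word x n)) y :> R[i] by rewrite xE.
have [xy|[p [e ne cp]]] := first_difference x y.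
  rewrite /expansion -xy subrr mul0r big1 => [|k _].
    by rewrite indicE mem_set // mulr1 subrr mulr0 addr0.
  rewrite /shell !indicE !mem_set ?subrr ?mulr0 //; exact/cyl_initial_word.
rewrite (path_kernelE hlam hlmax1 e ne) /expansion nuE (indic_initial_word _ cp).
have sh k : (k < n)%N -> shell x k y = (k == p)%:R.
  move=> kn; rewrite /shell !(indic_initial_word _ cp) leq_eqVlt.
  by case: ltngtP => //= _; rewrite ?subrr ?subr0.
have bp : (b <= p)%N.
  apply/cp; move: yb; rewrite /cyl /= -/b => ->.
  by symmetry; exact: (cyl_prefix pnu xnu).
(* If [n <= p], then [y] lies in C(nu), beyond all the shells of the sum. The tail has factor
   [lmax ^+ n] instead of [lmax ^+ p], which agrees for [p = n]; for larger [p] both sides vanish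
   because [h y = h x]. *)
have [np|pn] := leqP n p.
  rewrite big1 ?add0r => [|k _].
    rewrite mulr1; move: np; rewrite leq_eqVlt => /orP[/eqP ->|np].
      by rewrite mulrC.
    have -> : h y = h x by apply: dh.1; apply/cp.
    by rewrite subrr mul0r mulr0.
  have kn : (n - k - 1 < n)%N by have := ltn_ord k; lia.
  by rewrite sh // ltn_eqF ?mulr0 //; lia.
(* Here [y] is outside C(nu): the tail vanishes, and only the shell of level [p], which has index
   [n - p - 1], contains [y]. *)
have hy0 : h y = 0.
  apply: hnu => ynu; have : initial_word y n = initial_word x n by rewrite xE.
  by move=> /cp; rewrite leqNgt pn.
have kP : (n - p - 1 < n - b)%N by lia.
rewrite (bigD1 (Ordinal kP)) //= big1 => [|k kp].
  have -> : (n - (n - p - 1) - 1 = p)%N by lia.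
  by rewrite sh // eqxx mulr1 addr0 mulr0 hy0 !subr0 mulr0 addr0.
have kn : (n - k - 1 < n)%N by have := ltn_ord k; lia.
rewrite sh // (_ : (_ == p) = false) ?mulr0 //.
apply: contraNF kp => /eqP kp; apply/eqP/val_inj => /=.
by have := ltn_ord k; lia.
Qed.

(** Every shell in the sum has level at least [b], hence lies in C(gam.2). This makes [expansion x]
    deep, so that its lift can be integrated over the part. *)
Lemma expansion_eq0 (x y : X) : cyl nu x -> ~ cyl gam.2 y -> expansion x y = 0.
Proof.
move=> xnu yb.
have H m : (b <= m)%N -> \1_(cyl (initial_word x m)) y = 0 :> R[i].
  move=> bm; rewrite indicE memNset // => /cyl_initial_word /(initial_word_le bm) e.
  by apply: yb; rewrite /cyl /= e; exact: (cyl_prefix pnu xnu).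
have xE : initial_word x n = nu by [].
have Hnu : \1_(cyl nu) y = 0 :> R[i] by rewrite -xE H.
rewrite /expansion Hnu (dh.2 y yb) !mulr0 subrr mulr0 addr0.
apply: big1 => k _; have := ltn_ord k => kb.
by rewrite /shell !H ?subrr ?mulr0 //; lia.
Qed.

Lemma deep_expansion (x : X) : cyl nu x -> deep gam.2 n.+1 (expansion x).
Proof.
move=> xnu; split=> [y z yz|y]; last exact: expansion_eq0.
have H m : (m <= n.+1)%N ->
    \1_(cyl (initial_word x m)) y = \1_(cyl (initial_word x m)) z :> R[i].
  move=> mn; have e := initial_word_le mn yz.
  rewrite !indicE; congr (_%:R); congr nat_of_bool; apply/idP/idP.
    by move=> /set_mem /cyl_initial_word; rewrite e => /cyl_initial_word /mem_set.
  by move=> /set_mem /cyl_initial_word; rewrite -e => /cyl_initial_word /mem_set.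
have xE : initial_word x n = nu by [].
have Hnu : \1_(cyl nu) y = \1_(cyl nu) z :> R[i] by rewrite -xE H.
rewrite /expansion Hnu (dh.1 _ _ yz); congr (_ + _).
apply: eq_bigr => k _; rewrite /shell !H //; by have := ltn_ord k; lia.
Qed.

Lemma cintegral_expansion (x : X) : cyl nu x ->
  cintegral mu (expansion x) = (lambdaA A lmax u v gam.2 nu)%:C * h x.
Proof.
move=> xnu.
have xE : initial_word x n = nu by [].
have n0 : (0 < n)%N by exact: leq_trans bn.
have i1 m : (0 < m)%N -> cintegrable mu (\1_(cyl (initial_word x m)) : X -> R[i]).
  move=> m0; apply: cintegrable_indic; first exact: measurable_cyl.
  by apply: parry_fin; rewrite -size_eq0 size_initial_word -lt0n.
have ishell m : (0 < m)%N -> cintegrable mu (shell x m).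
  by move=> m0; apply: cintegrableB; exact: i1.
have vshell m : (0 < m)%N -> cintegral mu (shell x m) =
    (fine (mu (cyl (initial_word x m))) - fine (mu (cyl (initial_word x m.+1))))%:C.
  move=> m0; rewrite cintegralB; [|exact: i1|exact: i1].
  by rewrite !cintegral_indic ?rmorphB //; exact: measurable_cyl.
have km (k : 'I_(n - b)) : (0 < n - k - 1)%N by have := ltn_ord k; lia.
have inu : cintegrable mu (\1_(cyl nu) : X -> R[i]) by rewrite -xE; exact: i1.
have itail : cintegrable mu (fun y : X => h x * \1_(cyl nu) y - h y).
  by apply: cintegrableB => //; exact: cintegrableZ.
have vtail : cintegral mu (fun y : X => h x * \1_(cyl nu) y - h y) =
    h x * (fine (mu (cyl nu)))%:C.
  rewrite cintegralB //; last exact: cintegrableZ.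
  by rewrite cintegralZ // cintegral_indic ?h0 ?subr0 //; exact: measurable_cyl.
rewrite /expansion cintegralD; last by apply: cintegrableZ.
  rewrite cintegral_sum; last by move=> k; apply: cintegrableZ; exact: ishell.
  rewrite cintegralZ // vtail /lambdaA -/n -/b.
  have lt j : (0 < j <= n)%N -> letter nu j = coord x j.-1.
    by case: j => // j jn; rewrite /letter -xE nth_initial_word.
  rewrite !lt ?n0 ?leqnn // rmorphD mulrDl addrC; congr (_ + _).
    (* The factor [lmax ^- n.-1] in [mu (cyl nu)] cancels all but one factor of [lmax ^+ n], leaving
       the leading term of [lambdaA]. *)
    rewrite mulrCA mulrC -rmorphM; congr (_%:C * _).
    rewrite -xE -(prednK n0) parry_initial_word.
    have := expf_neq0 n.-1 (lt0r_neq0 lmax0).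
    rewrite [lmax ^+ _.+1]exprS /=; set p := lmax ^+ _ => p0.
    by field.
  rewrite mulr_sumr rmorph_sum mulr_suml; apply: eq_bigr => k _.
  rewrite cintegralZ; last exact: ishell.
  rewrite vshell // -mulrA mulrC -rmorphM; congr (_%:C * _).
  (* The shell of level m + 1 has measure v (u_i lmax^-m - u_j lmax^-(m+1)), where i and j are the
     letters m + 1 and m + 2 of [nu]. Multiplication by lmax^(m+1) turns this into lmax v u_i (1 -
     P_ij). *)
  have [m mE] : exists m, (n - k - 1 = m.+1)%N.
    by exists (n - k - 2)%N; have := ltn_ord k; lia.
  have mE' : (n - k = m.+2)%N by lia.
  rewrite mE mE' !parry_initial_word !lt; [|by have := ltn_ord k; lia..].
  rewrite /trans_prob coord_adm mul1r [(_.+1).-1]/= !exprS.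
  have := expf_neq0 m (lt0r_neq0 lmax0).
  have := lt0r_neq0 lmax0; have := lt0r_neq0 (u0 (coord x m)).
  set p := lmax ^+ _ => uu ll p0.
  by field; rewrite ll uu p0.
by apply: cintegrable_sum => k; apply: cintegrableZ; exact: ishell.
Qed.

Lemma Laplacian0_glift (g : G) :
  Laplacian0 muG lam lmax (glift gam h) g =
  (lambdaA A lmax u v gam.2 nu)%:C * glift gam h g.
Proof.
rewrite /Laplacian0; have [gg|ng] := pselect (Gpart gam g); last first.
  rewrite [glift gam h g]glift0 // mulr0 -[RHS](cintegral0 muG).
  apply: eq_cintegral => g2; have [g2g|ng2] := pselect (Gpart gam g2); last first.
    by rewrite glift0 // subrr mul0r.
  rewrite (@kernel_neq _ _ _ _ _ _ (ell_r g, ell_s g)) ?mulr0 // => -[r s].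
  by apply: ng; move: g2g; rewrite /Gpart /= r s.
rewrite gliftE //.
(* The kernel vanishes between different parts, so the integrand is the lift of any function that
   agrees with it on C(gam.2). This leaves freedom to choose a deep one. *)
have FE phi : (forall y, cyl gam.2 y ->
      (h (src g) - h y) * (path_kernel lam lmax (src g) y)%:C = phi y) ->
    cintegral muG (fun g2 => (h (src g) - glift gam h g2) * (kernel lam lmax g g2)%:C) =
    cintegral muG (glift gam phi).
  move=> H; apply: eq_cintegral => g2.
  have [g2g|ng2] := pselect (Gpart gam g2).
    by rewrite !gliftE // (kernel_eq _ _ gg g2g) H //; exact: Gpart_src g2g.
  by rewrite [glift gam phi g2]glift0 // (kernel_neq _ _ gg ng2) mulr0.
have [xnu|xnu] := pselect (cyl nu (src g)).
  rewrite (FE (expansion (src g))); last by move=> y; exact: expansionE.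
  rewrite (glift_cintegral hmuG parry_fin gI (deep_expansion xnu)).
  exact: cintegral_expansion.
have hx0 := hnu xnu.
(* At the least position [i] where the source leaves [nu], it leaves every point of C(nu); the
   kernel there is the constant [lmax ^+ i]. *)
have [i /andP[ilt ine] imin] : exists2 i, (i < n)%N && (coord (src g) i != nth ord0 nu i)
   & forall j, (j < n)%N && (coord (src g) j != nth ord0 nu j) -> (i <= j)%N.
  suff ex : exists i, (i < n)%N && (coord (src g) i != nth ord0 nu i).
    by case: (ex_minnP ex) => i h1 h2; exists i.
  apply: contrapT => ex; apply: xnu; apply/cylP => i ilt; apply/eqP.
  by apply: contrapT => /negP ine; apply: ex; exists i; rewrite ilt.
rewrite (FE (fun y => - (lmax ^+ i)%:C * h y)) => [|y yb]; last first.
  have [ynu|ynu] := pselect (cyl nu y); last by rewrite hx0 hnu // subrr mulr0 mul0r.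
  rewrite (@path_kernelE _ _ _ _ _ _ hlam hlmax1 _ _ i).
  - by rewrite hx0 sub0r mulNr mulrC mulNr.
  - apply/initial_wordP => j ji; have jn := ltn_trans ji ilt.
    rewrite ((cylP _ _).1 ynu) //.
    apply/eqP; apply: contraTT ji => jne; rewrite -leqNgt; apply: imin.
    by rewrite jn jne.
  - by rewrite ((cylP _ _).1 ynu).
have dch : deep gam.2 n.+1 (fun y => - (lmax ^+ i)%:C * h y).
  by split=> [y z yz|y yb]; [rewrite (dh.1 _ _ yz)|rewrite dh.2 // mulr0].
by rewrite (glift_cintegral hmuG parry_fin gI dch) cintegralZ // h0 hx0 !mulr0.
Qed.

End LaplacianEigen.

(** * Density *)

Section GroupoidDensity.
Context {R : realType} {N : nat} {A : 'M[bool]_N.+1} {hA : primitive A}.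
Local Notation X := (path_space hA).
Local Notation G := (groupoid hA).
Variable mu : {measure set (borel X) -> \bar R}.
Variable muG : {measure set (borel G) -> \bar R}.
Hypothesis hmuG : groupoid_measure mu muG.
Hypothesis mu_fin : forall w : word N, w != [::] -> (mu (cyl w) < +oo)%E.
Variable S : set (G -> R[i]).
Hypothesis SL : S `<=` L2 muG.
Local Notation V := (closed_span muG S).
Hypothesis VZ : forall gam (w : word N), IA A gam -> prefix gam.2 w ->
  V \1_(Zpart gam w).

(** The empty set is included for stability under intersection. *)
Definition basic_sets : set (set G) := [set B | B = set0 \/
  exists gam (w : word N), [/\ IA A gam, prefix gam.2 w & B = Zpart gam w]].

Lemma basic_open : basic_sets `<=` open.
Proof.
by move=> B [->|[gam [w [_ _ ->]]]]; [exact: open0|exact: Zpart_open].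
Qed.

(** Two parts with a common arrow coincide, and two cylinders with a common point are nested, so a
    nonempty intersection is the set with the longer word. *)
Lemma basic_setI : setI_closed basic_sets.
Proof.
move=> B C [->|[gam [w [gI pw ->]]]]; first by rewrite set0I; left.
move=> [->|[gam' [w' [gI' pw' ->]]]]; first by rewrite setI0; left.
have [[g [[gg gw] [gg' gw']]]|ne] := 
    pselect ((Zpart gam w `&` Zpart gam' w' : set G) !=set0);
  last first.
  by left; apply/seteqP; split=> // g gB; apply: ne; exists g.
rewrite -(Gpart_disj gg gg') {gI' gg'} in pw' *.
wlog ww : w w' pw pw' gw gw' / (size w <= size w')%N => [H|].
  by have [/H|/ltnW /H] := leqP (size w) (size w'); last rewrite setIC; apply.
right; exists gam, w'; split => //; apply/seteqP; split => [k []//|k [kg kw']].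
split => //; split => //=.
move: gw gw' kw'; rewrite /cyl /= => gw gw' kw'.
by rewrite -[RHS]gw; apply: (initial_word_le ww); rewrite kw' gw'.
Qed.

(** By [nbhs_Zpart] an open set is the union of the basic sets it contains; pairs of a part and a
    word are countable, so [unpickle] makes this a countable union. *)
Lemma measurable_basic : @measurable _ (borel G) = <<s basic_sets >>.
Proof.
apply/seteqP; split; apply: smallest_sub; try exact: smallest_sigma_algebra.
  move=> U oU.
  pose F n : set G := if unpickle n is Some (gam, w) then
    if pselect [/\ IA A gam, prefix gam.2 w & Zpart gam w `<=` U]
    then Zpart gam w else set0 else set0.
  have -> : U = \bigcup_n F n.
    apply/seteqP; split=> [g Ug|g [n _]].
      have [_ _ b0 _ _] := IA_ell g.
      have [n ln sU] := nbhs_Zpart b0 (Gpart_ell g) (open_nbhs_nbhs (conj oU Ug)).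
      exists (pickle ((ell_r g, ell_s g), initial_word (src g) n)) => //.
      rewrite /F pickleK; case: pselect => [?|[]] /=.
        by split; [exact: Gpart_ell|rewrite /= /cyl /= size_initial_word].
      split => //; first exact: IA_ell.
      rewrite prefixE size_initial_word /= take_initial_word //.
      by rewrite -(size_initial_word (src g) (kappa g).+1).
    by rewrite /F; case: (unpickle n) => [[gam w]|] //; case: pselect => [[? ? sU]|] //= /sU.
  apply: sigma_algebra_bigcup => n; rewrite /F.
  case: (unpickle n) => [[gam w]|]; last by apply: sub_sigma_algebra; left.
  case: pselect => [[gI pw ?]|?] /=; apply: sub_sigma_algebra; last by left.
  by right; exists gam, w.
by move=> B /basic_open oB; exact: sub_sigma_algebra.
Qed.

(** Dynkin induction inside one part: complements are taken relative to it, and its finite measure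
    makes countable disjoint unions converge in norm. *)
Lemma closed_span_Gpart_indic gam (B : set (borel G)) : IA A gam -> measurable B ->
  V \1_(B `&` Gpart gam).
Proof.
move=> gI; have [_ _ b0 _ _] := gI; rewrite {1}measurable_basic; move: B.
have VG : V \1_(Gpart gam).
  by rewrite -(Zpart_Gpart _ b0); apply: VZ => //; exact: prefix_refl.
have Gfin : (muG (Gpart gam) < +oo)%E.
  rewrite -(Zpart_Gpart _ b0) (muG_Zpart hmuG gI (prefix_refl _)); exact: mu_fin.
have mG : measurable (Gpart gam : set (borel G)) by exact: measurable_Gpart.
apply: (@dynkin_induction _ (borel G) basic_sets).
- exact: measurable_basic.
- exact: basic_setI.
- by rewrite setTI.
- move=> B [->|[gam' [w [gI' pw ->]]]].
    by rewrite set0I indic0; exact: closed_span0.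
  have [e|e] := eqVneq gam' gam.
    rewrite -e in pw gI *; rewrite (_ : _ `&` _ = Zpart gam' w); first exact: VZ.
    by apply/seteqP; split=> [g []//|g gZ]; split => //; case: gZ.
  rewrite (_ : _ `&` _ = set0) ?indic0; first exact: closed_span0.
  rewrite -subset0 => g [[gg' _] gg]; by rewrite (Gpart_disj gg gg') eqxx in e.
- move=> B mB VB.
  have -> : \1_(~` B `&` Gpart gam) =
     (fun g : G => \1_(Gpart gam) g + (-1) * \1_(B `&` Gpart gam) g) :> (G -> R[i]).
    apply/funext => g; rewrite !indicE !in_setI in_setC mulN1r.
    by case: (g \in B); case: (g \in Gpart gam); rewrite /= ?subrr ?subr0.
  by apply: closed_spanD => //; exact: closed_spanZ.
- move=> F mF tF VF; rewrite setI_bigcupl; apply: closed_span_bigcup => //.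
  + by move=> n; exact: measurableI.
  + exact: trivIset_setIr.
  + apply: le_lt_trans Gfin; apply: le_measure; rewrite ?inE //.
      by apply: bigcupT_measurable => n; exact: measurableI.
    by move=> g [n _ []].
Qed.

Lemma groupoid_L2_closed_span : L2 muG `<=` V.
Proof.
apply: L2_closed_span => // B mB Bfin.
(* With [pickle_inv] instead of [unpickle], distinct codes give distinct parts, so the pieces are
   disjoint. *)
pose F n : set (borel G) := if pickle_inv n is Some gam then
  if pselect (IA A gam) then B `&` Gpart gam else set0 else set0.
have BE : B = \bigcup_n F n.
  apply/seteqP; split=> [g Bg|g [n _]].
    exists (pickle (ell_r g, ell_s g)) => //; rewrite /F pickleK_inv.
    by case: pselect => [?|[]] /=; [split|exact: IA_ell].
  by rewrite /F; case: (pickle_inv n) => // gam; case: pselect => //= ? [].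
have Fmeas n : measurable (F n).
  rewrite /F; case: (pickle_inv n) => // gam; case: pselect => //= ?.
  by apply: measurableI => //; exact: measurable_Gpart.
rewrite BE; apply: closed_span_bigcup => //.
- apply/trivIsetP => m n _ _ mn; rewrite -subset0 => g []; rewrite /F.
  case em : (pickle_inv m) => [gam|] //; case: pselect => //= ? [_ gg].
  case en : (pickle_inv n) => [gam'|] //; case: pselect => //= ? [_ gg'].
  have := @pickle_invK (word N * word N)%type m; have := @pickle_invK (word N * word N)%type n.
  rewrite em en /= => e1 e2; move: mn.
  by rewrite -e1 -e2 (Gpart_disj gg gg') eqxx.
- by rewrite -BE.
- move=> n; rewrite /F; case: (pickle_inv n) => [gam|]; last first.
    by rewrite indic0; exact: closed_span0.
  case: pselect => gI /=; last by rewrite indic0; exact: closed_span0.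
  exact: closed_span_Gpart_indic.
Qed.
End GroupoidDensity.

(** * The eigenbasis *)

Section Basis.
Context {R : realType} {N : nat} {A : 'M[bool]_N.+1} {hA : primitive A}.
Local Notation X := (path_space hA).
Local Notation G := (groupoid hA).
Variables (lmax : R) (u v : 'cV[R]_N.+1).
Hypotheses (hlmax1 : 1 < lmax) (huv : PF_eigenvectors A lmax u v).
Variable mu : {measure set (borel X) -> \bar R}.
Hypothesis hmu : parry_measure lmax u v mu.
Variables (J : word N -> word N -> {set 'I_N.+1})
  (h : word N -> word N -> 'I_N.+1 -> X -> R[i]).
Hypothesis hh : level_basis mu J h.

Lemma cyl_span_deep bet n (f : X -> R[i]) :
  cyl_span bet n f -> deep bet (size bet + n) f.
Proof.
move=> [m [c [e [Se fe]]]].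
have de i : @deep _ _ _ hA bet (size bet + n) (e i).
  have [w sw ->] := Se i; rewrite -sw -size_cat.
  by apply: deep_indic; exact: prefix_prefix.
split=> [x y xy|x xb]; rewrite !fe.
  by apply: eq_bigr => i _; rewrite ((de i).1 _ _ xy).
by apply: big1 => i _; rewrite (de i).2 // mulr0.
Qed.

Lemma indic_cyl_rcons (w : word N) (x : X) :
  \1_(cyl w) x = \sum_(a : 'I_N.+1) \1_(cyl (rcons w a)) x :> R[i].
Proof.
have cr a : cyl (rcons w a) x <-> cyl w x /\ coord x (size w) = a.
  rewrite /cyl /= size_rcons initial_wordS; split.
    by move=> /rcons_inj[-> ->].
  by move=> [-> ->].
rewrite (bigD1 (coord x (size w))) //= big1 ?addr0 => [|a ne].
  rewrite !indicE; congr (_%:R); congr nat_of_bool; apply/idP/idP.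
    by move=> /set_mem xw; apply/mem_set/cr.
  by move=> /set_mem /cr[xw _]; exact/mem_set.
rewrite indicE memNset // => /cr[_ e].
by rewrite e eqxx in ne.
Qed.

Section Word.
Variable bet : word N.
Hypotheses (Abet : admissible A bet) (bet0 : bet != [::]).

Lemma frakIA_level nu j : admissible A nu -> prefix bet nu -> j \in J bet nu ->
  level_index A J bet (size nu - size bet).+1 (nu, j).
Proof.
move=> Anu pnu jJ; split => //=.
by rewrite addnS subn1 subnKC // size_prefix.
Qed.

Variables (nu : word N) (j : 'I_N.+1) (k : nat).
Hypotheses (k0 : (0 < k)%N) (kI : level_index A J bet k (nu, j)).

Lemma h_level : level mu bet k (h bet nu j).
Proof. by have [_ /(_ _ k0) [H _ _] _] := hh Abet bet0; exact: (H (nu, j)). Qed.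

Lemma size_level_index : (size bet + k = (size nu).+1)%N.
Proof. by have [_ _ /= -> _] := kI; rewrite subn1 prednK // addn_gt0 k0 orbT. Qed.

Lemma h_deep : deep bet (size nu).+1 (h bet nu j).
Proof. by rewrite -size_level_index; apply: cyl_span_deep; exact: h_level.1. Qed.

Lemma h_support (x : X) : ~ cyl nu x -> h bet nu j x = 0.
Proof. by have [_ _ H] := hh Abet bet0; have [H1 _] := H _ _ k0 kI; exact: H1. Qed.

Lemma cyl_span_indic (w : word N) :
  @cyl_span R N A hA bet (size w) \1_(cyl (bet ++ w)).
Proof. by apply: span_id; exists w. Qed.

Lemma h_cdot_indic : cdot mu (h bet nu j) \1_(cyl bet) = 0.
Proof.
have [_ H] := h_level; apply: (H 0%N) => //.
by have := cyl_span_indic [::]; rewrite cats0.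
Qed.

(** Orthogonality to level 0 is the mean-zero property, since the indicator of C(bet) equals 1
    wherever [h] is nonzero. *)
Lemma h_cintegral : cintegral mu (h bet nu j) = 0.
Proof.
rewrite -h_cdot_indic; apply: eq_cintegral => x; rewrite indicE.
have [xb|xb] := pselect (cyl bet x); first by rewrite mem_set // rmorph1 mulr1.
by rewrite memNset // rmorph0 mulr0 h_deep.2.
Qed.
End Word.

Lemma hnorm_deep bet : @deep R N A hA bet (size bet) (hnorm mu bet).
Proof.
have [d1 d2] := @deep_indic R N A hA bet bet (prefix_refl bet).
split=> [x y xy|x xb]; rewrite /hnorm; first by rewrite (d1 _ _ xy).
by rewrite d2 // mulr0.
Qed.

Lemma hnorm_cdot bet : admissible A bet -> bet != [::] ->
  cdot mu (hnorm mu bet) (hnorm mu bet) = 1.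
Proof.
move=> Ab b0; have m0 := parry_gt0 hlmax1 huv hmu Ab b0.
set m := fine (mu (cyl bet)) in m0 *.
transitivity (cintegral mu (fun x : X => (m^-1)%:C * \1_(cyl bet) x)).
  apply: eq_cintegral => x; rewrite /hnorm -/m indicE.
  have -> : m^-1 = (Num.sqrt m)^-1 * (Num.sqrt m)^-1.
    by rewrite -invfM -expr2 sqr_sqrtr // ltW.
  by case: (x \in cyl bet); rewrite ?mulr1 ?mulr0 ?mul0r //;
    apply: complexP => /=; rewrite ?oppr0 ?mulr0 ?mul0r ?subr0 ?addr0.
rewrite cintegralZ ?cintegral_indic -/m.
- by rewrite -rmorphM mulVf // gt_eqF.
- exact: measurable_cyl.
- apply: cintegrable_indic; first exact: measurable_cyl.
  exact: parry_fin hmu _ b0.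
Qed.

Definition bet_basis bet : set (X -> R[i]) := [set f | f = hnorm mu bet \/
  exists k nu j, [/\ (0 < k)%N, level_index A J bet k (nu, j) & f = h bet nu j]].

(* Subtracting from [1_C(bet w a)] its conditional expectation, a multiple of
[1_C(bet w)], gives a function of level [|w| + 1]. *)
Lemma cyl_in_span bet (w : word N) : admissible A bet -> bet != [::] ->
  span (T := borel X) (bet_basis bet) \1_(cyl (bet ++ w)).
Proof.
move=> Ab b0; elim/last_ind: w => [|w a IH].
  rewrite cats0.
  have m0 := parry_gt0 hlmax1 huv hmu Ab b0.
  have -> : \1_(cyl bet) = (fun x : X =>
      (Num.sqrt (fine (mu (cyl bet))))%:C * hnorm mu bet x).
    apply/funext => x; rewrite /hnorm mulrA -rmorphM divff ?mul1r //.
    by rewrite gt_eqF // sqrtr_gt0.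
  by apply: spanZ; apply: span_id; left.
rewrite -rcons_cat; set w' := bet ++ w; set n := size w.
have w'0 : w' != [::] by rewrite -size_eq0 size_cat addn_eq0 size_eq0 (negbTE b0).
have wa0 : rcons w' a != [::] by rewrite -size_eq0 size_rcons.
have [Aw|nA] := boolP (admissible A (rcons w' a)); last first.
  have -> : \1_(cyl (rcons w' a)) = (fun _ : X => 0 : R[i]).
    apply/funext => x; rewrite indicE memNset // => /cyl_admissible.
    by rewrite (negbTE nA).
  exact: span0.
have Aw' : admissible A w'.
  have [x xw] := cyl_nonempty hA Aw; apply: (@cyl_admissible _ _ hA _ x).
  by apply: (@cyl_prefix _ _ hA w' (rcons w' a)) => //; exact: prefix_rcons.
have m0 := parry_gt0 hlmax1 huv hmu Aw' w'0.
set m := fine (mu (cyl w')) in m0.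
set m' := fine (mu (cyl (rcons w' a))).
pose f (x : X) : R[i] := \1_(cyl (rcons w' a)) x - (m' / m)%:C * \1_(cyl w') x.
have mc w2 : measurable (cyl w2 : set (borel X)) by exact: measurable_cyl.
have i1 : cintegrable mu (\1_(cyl (rcons w' a)) : X -> R[i]).
  by apply: cintegrable_indic => //; exact: parry_fin hmu _ wa0.
have i2 : cintegrable mu (\1_(cyl w') : X -> R[i]).
  by apply: cintegrable_indic => //; exact: parry_fin hmu _ w'0.
have f0 : cintegral mu f = 0.
  rewrite /f cintegralB //; last exact: cintegrableZ.
  rewrite cintegralZ // !cintegral_indic // -rmorphM divfK ?subrr //.
  by rewrite gt_eqF.
have lf : level mu bet n.+1 f.
  split.
    have s1 b : cyl_span bet n.+1 (\1_(cyl (rcons w' b)) : X -> R[i]).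
      by rewrite /w' rcons_cat -(size_rcons w b); exact: cyl_span_indic.
    have -> : f = (fun x => \1_(cyl (rcons w' a)) x +
        (- (m' / m)%:C) * \sum_(b : 'I_N.+1) \1_(cyl (rcons w' b)) x).
      by apply/funext => x; rewrite /f -indic_cyl_rcons mulNr.
    by apply: spanD; [exact: s1|apply: spanZ; exact: span_big].
  move=> k g kn /cyl_span_deep /(deep_le (n := size bet + n)).
  rewrite leq_add2l => /(_ kn) [dg _].
  have [x0 x0w] := cyl_nonempty hA Aw'.
  (* A function from a lower span is constant on C(w'), where [f] is supported, so the inner product
     is a multiple of the integral of [f], which is 0. *)
  transitivity (cintegral mu (fun x : X => (g x0)^*%C * f x)).
    apply: eq_cintegral => x; have [xw|xw] := pselect (cyl w' x).
      rewrite mulrC; congr (_^* * _); apply: dg.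
      by move: xw x0w; rewrite /cyl /= size_cat => -> ->.
    have -> : f x = 0; last by rewrite mul0r mulr0.
    rewrite /f !indicE !memNset ?mulr0 ?subrr // => /(@cyl_prefix _ _ hA w').
    by move=> H; apply: xw; apply: H; exact: prefix_rcons.
  rewrite cintegralZ ?f0 ?mulr0 //.
  by apply: cintegrableB => //; exact: cintegrableZ.
have -> : \1_(cyl (rcons w' a)) = (fun x : X => f x + (m' / m)%:C * \1_(cyl w') x).
  by apply/funext => x; rewrite /f subrK.
apply: spanD; last exact: spanZ.
have [_ /(_ _ (ltn0Sn n)) [_ _ /(_ _ lf) lS] _] := hh Ab b0.
have [r [c [e [Se fe]]]] := lS; exists r, c, e; split=> // i.
by have [[nu j] pI <-] := Se i; right; exists n.+1, nu, j.
Qed.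

End Basis.

(** * From eigenfunctions of the Laplacian on a part to eigenfunctions of D *)

Section DiracEigen.
Context {R : realType} {N : nat} {A : 'M[bool]_N.+1} {hA : primitive A}.
Local Notation X := (path_space hA).
Local Notation G := (groupoid hA).
Variables (lam lmax : R).
Variable mu : {measure set (borel X) -> \bar R}.
Variable muG : {measure set (borel G) -> \bar R}.
Hypothesis hmuG : groupoid_measure mu muG.
Hypothesis mu_fin : forall w : word N, w != [::] -> (mu (cyl w) < +oo)%E.

Lemma normsq0 d (T : measurableType d) (m : {measure set T -> \bar R}) (f : T -> R[i]) :
  (forall x, f x = 0) -> normsq m f = 0%E.
Proof.
move=> f0; rewrite /normsq (eq_integral (cst 0%E)) ?integral0 // => x _.
by rewrite f0 /= expr0n addr0.
Qed.

Lemma Gpart_fin gam : IA A gam -> (muG (Gpart gam) < +oo)%E.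
Proof.
move=> gI; have [_ _ b0 _ _] := gI.
rewrite -(Zpart_Gpart _ b0) (muG_Zpart hmuG gI (prefix_refl _)); exact: mu_fin.
Qed.

Lemma FA_gens_L2 : ([set f | exists gam : word N * word N,
    [/\ IA A gam, size gam.2 = 1%N & f = \1_(Gpart gam)]] : set (borel G -> R[i]))
  `<=` L2 muG.
Proof.
move=> f [gam [gI _ ->]]; apply: L2_indic; first exact: measurable_Gpart.
exact: Gpart_fin.
Qed.

Variables (gam : word N * word N) (n : nat) (phi : X -> R[i]) (a : R[i]).
Hypotheses (gI : IA A gam) (dphi : deep gam.2 n phi).
Local Notation f := (glift gam phi : G -> R[i]).
Hypothesis Lf : forall g, Laplacian0 muG lam lmax f g = a * f g.

Let f2 : L2 muG f.
Proof. exact (glift_L2 hmuG mu_fin gI dphi). Qed.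

Lemma Laplacian_eigen : Laplacian muG lam lmax f (fun g => a * f g).
Proof.
split=> //; first exact: L2Z.
exists (fun=> f); split.
- by move=> _; exact (glift_Ccinfty gI dphi).
- rewrite (_ : (fun _ : nat => _) = cst 0%E); first exact: cvg_cst.
  by apply/funext => k; apply: normsq0 => g; rewrite subrr.
- rewrite (_ : (fun _ : nat => _) = cst 0%E); first exact: cvg_cst.
  by apply/funext => k; apply: normsq0 => g; rewrite Lf subrr.
Qed.

Let ellE g : (ell g)%:R * f g = (gam_size gam)%:R * f g.
Proof.
have [gg|gg] := pselect (Gpart gam g); last by rewrite glift0 // !mulr0.
by move: gg => [r s]; rewrite /ell r s; case: gam.
Qed.

Lemma Dirac_pos : FA muG f ->
  Dirac muG lam lmax f (fun g => (a + (gam_size gam)%:R) * f g).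
Proof.
(* Being a multiple of [f], the image under Delta + M_ell lies in F_A and is its own projection. *)
move=> Ff; exists (fun g => a * f g), (fun g => (a + (gam_size gam)%:R) * f g).
split.
- exact: Laplacian_eigen.
- by under eq_fun do rewrite ellE; exact: L2Z.
- split; first exact (closed_spanZ FA_gens_L2 _ Ff).
  move=> g _; rewrite /cdot -[RHS](cintegral0 muG); apply: eq_cintegral => x.
  by rewrite ellE -mulrDl subrr mul0r.
- exact: L2Z.
- by apply: aeW => x; rewrite ellE mulr2n -[in X in _ - X]mulrDl addrK.
Qed.

Lemma Dirac_neg : (forall gam', IA A gam' -> size gam'.2 = 1%N ->
    cdot muG f \1_(Gpart gam') = 0) ->
  Dirac muG lam lmax f (fun g => - ((gam_size gam)%:R + a) * f g).
Proof.
(* Orthogonality to the generators of F_A extends to their closed span, so the projection is 0 and 2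
   P_A - 1 acts as -1. *)
move=> orth; exists (fun g => a * f g), (fun=> 0).
split.
- exact: Laplacian_eigen.
- by under eq_fun do rewrite ellE; exact: L2Z.
- split; first exact (closed_span0 FA_gens_L2).
  move=> g Fg.
  have -> : (fun x => a * f x + (ell x)%:R * f x - 0) =
      (fun x => (a + (gam_size gam)%:R) * f x).
    by apply/funext => x; rewrite ellE subr0 mulrDl.
  apply: (cdot_closed_span_eq0 (L2Z _ f2) FA_gens_L2 _ Fg).
  move=> _ [gam' [gI' s1 ->]].
  rewrite (cdotZl _ f2); first by rewrite orth ?mulr0.
  by apply: L2_indic; [exact: measurable_Gpart|exact: Gpart_fin].
- exact: L2Z.
- by apply: aeW => x; rewrite ellE mul0rn sub0r -mulrDl mulNr addrC.
Qed.
End DiracEigen.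

(** * Orthonormality, completeness and Laplace eigenvalues of the basis *)

Section GroupoidBasis.
Context {R : realType} {N : nat} {A : 'M[bool]_N.+1} {hA : primitive A}.
Local Notation X := (path_space hA).
Local Notation G := (groupoid hA).
Variables (lam lmax : R) (u v : 'cV[R]_N.+1).
Hypotheses (hlam : 1 < lam) (hlmax1 : 1 < lmax) (huv : PF_eigenvectors A lmax u v).
Variable mu : {measure set (borel X) -> \bar R}.
Hypothesis hmu : parry_measure lmax u v mu.
Variable muG : {measure set (borel G) -> \bar R}.
Hypothesis hmuG : groupoid_measure mu muG.
Variables (J : word N -> word N -> {set 'I_N.+1})
  (h : word N -> word N -> 'I_N.+1 -> X -> R[i]).
Hypothesis hh : level_basis mu J h.

Let mu_fin := parry_fin hmu.

Lemma basis_fun_inl gam :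
  basis_fun mu h (inl gam) = glift gam (hnorm mu gam.2) :> (G -> R[i]).
Proof. by []. Qed.

Lemma basis_fun_inr gam nu j :
  basis_fun mu h (inr (gam, nu, j)) = glift gam (h gam.2 nu j) :> (G -> R[i]).
Proof. by []. Qed.

Lemma frakIA_deep gam nu j : frakIA A J (gam, nu, j) ->
  deep gam.2 (size nu).+1 (h gam.2 nu j).
Proof.
move=> [/= [_ Ab b0 _ _] Anu pnu jJ].
exact (h_deep hh Ab b0 (ltn0Sn _) (frakIA_level Anu pnu jJ)).
Qed.

Lemma frakIA_hnorm_deep gam nu j : frakIA A J (gam, nu, j) ->
  @deep R N A hA gam.2 (size nu).+1 (hnorm mu gam.2).
Proof.
move=> [_ _ pnu _]; apply: deep_le (hnorm_deep mu gam.2).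
exact: leq_trans (size_prefix pnu) (leqnSn _).
Qed.

(** Brings both families into one form, so that smoothness and square-integrability need a single
    argument. *)
Lemma basis_fun_deep i : basis_domain A J i -> exists gam n phi,
  [/\ IA A gam, @deep R N A hA gam.2 n phi & basis_fun mu h i = glift gam phi].
Proof.
case: i => [gam gI|[[gam nu] j] tI].
  by exists gam, (size gam.2), (hnorm mu gam.2); split => //; exact: hnorm_deep.
exists gam, (size nu).+1, (h gam.2 nu j); split => //; first by case: tI.
exact: frakIA_deep.
Qed.

Lemma basis_fun_L2 i : basis_domain A J i -> L2 muG (basis_fun mu h i).
Proof.
move=> /basis_fun_deep [gam [n [phi [gI dphi ->]]]].
exact (glift_L2 hmuG mu_fin gI dphi).
Qed.

Lemma hnorm_h_cdot gam nu j : frakIA A J (gam, nu, j) ->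
  cdot mu (h gam.2 nu j) (hnorm mu gam.2) = 0.
Proof.
move=> tI; have dh := frakIA_deep tI; have [/= gI Anu pnu jJ] := tI.
have [_ Ab b0 _ _] := gI; have kI := frakIA_level Anu pnu jJ.
have h0 := h_cintegral hh Ab b0 (ltn0Sn _) kI.
set c := ((Num.sqrt (fine (mu (cyl gam.2))))^-1)%:C : R[i].
transitivity (cintegral mu (fun x : X => c^* * h gam.2 nu j x)).
  apply: eq_cintegral => x; rewrite /hnorm -/c indicE.
  have [xb|xb] := pselect (cyl gam.2 x); first by rewrite mem_set // mulr1 mulrC.
  by rewrite dh.2 // mul0r mulr0.
rewrite cintegralZ ?h0 ?mulr0 //.
exact (deep_cintegrable mu_fin gI dh).
Qed.

(** Words of different lengths belong to different levels, and a level is orthogonal to all lower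
    ones by definition; conjugate symmetry covers the other order. Words of equal length lie in one
    level, where [level_basis] supplies orthonormality. *)
Lemma h_cdot gam nu j nu' j' : frakIA A J (gam, nu, j) -> frakIA A J (gam, nu', j') ->
  cdot mu (h gam.2 nu j) (h gam.2 nu' j') = ((nu, j) == (nu', j'))%:R.
Proof.
move=> tI tI'; have [[/= _ Ab b0 _ _] _ _ _] := tI.
have key nu1 j1 nu2 j2 : frakIA A J (gam, nu1, j1) -> frakIA A J (gam, nu2, j2) ->
    (size nu2 < size nu1)%N -> cdot mu (h gam.2 nu1 j1) (h gam.2 nu2 j2) = 0.
  move=> [/= _ A1 p1 J1] [/= _ A2 p2 J2] lt.
  have [_ H] := h_level hh Ab b0 (ltn0Sn _) (frakIA_level A1 p1 J1).
  have [C _] := h_level hh Ab b0 (ltn0Sn _) (frakIA_level A2 p2 J2).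
  by apply: H C; rewrite ltnS ltn_sub2r //; exact: leq_ltn_trans (size_prefix p2) lt.
have [lt|lt|e] := ltngtP (size nu) (size nu').
- rewrite cdotC; last first.
    have d1 := frakIA_deep tI; have d2 := frakIA_deep tI'.
    apply: (deep_cintegrable mu_fin _ (deepM d2 (deep_le _ d1))); first by case: tI.
    by rewrite ltnS ltnW.
  rewrite key // rmorph0 (_ : (_ == _) = false) //.
  by apply/eqP => -[e _]; rewrite e ltnn in lt.
- rewrite key // (_ : (_ == _) = false) //.
  by apply/eqP => -[e _]; rewrite e ltnn in lt.
- have [/= _ A1 p1 J1] := tI; have [/= _ A2 p2 J2] := tI'.
  have [_ /(_ _ (ltn0Sn (size nu - size gam.2))) [_ O _] _] := hh Ab b0.
  apply: (O (nu, j) (nu', j')); first exact: frakIA_level.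
  by rewrite e; exact: frakIA_level.
Qed.

Lemma basis_fun_orthonormal : orthonormal muG (basis_domain A J) (basis_fun mu h).
Proof.
move=> [gam|[[gam nu] j]] [gam'|[[gam' nu'] j']] /= iI iI'.
- have [<-|ne] := eqVneq gam gam'; last first.
    rewrite !basis_fun_inl glift_cdot_neq // (_ : (_ == _) = false) //.
    by apply: contraNF ne => /eqP[->].
  rewrite eqxx (glift_cdot hmuG mu_fin iI (hnorm_deep _ _) (hnorm_deep _ _)).
  have [_ Ab b0 _ _] := iI; exact (hnorm_cdot hlmax1 huv hmu Ab b0).
- rewrite basis_fun_inl basis_fun_inr.
  have [e|ne] := eqVneq gam gam'; last by rewrite glift_cdot_neq.
  move: iI; rewrite {}e => gI; have d1 := frakIA_deep iI'.
  have d2 := frakIA_hnorm_deep iI'.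
  rewrite (glift_cdot hmuG mu_fin gI d2 d1) cdotC; last first.
    exact (deep_cintegrable mu_fin gI (deepM d1 d2)).
  by rewrite hnorm_h_cdot // rmorph0.
- rewrite basis_fun_inl basis_fun_inr.
  have [e|ne] := eqVneq gam gam'; last by rewrite glift_cdot_neq.
  move: iI'; rewrite -{}e => gI.
  rewrite (glift_cdot hmuG mu_fin gI (frakIA_deep iI) (frakIA_hnorm_deep iI)).
  by rewrite hnorm_h_cdot.
- rewrite !basis_fun_inr.
  have [e|ne] := eqVneq gam gam'; last first.
    rewrite glift_cdot_neq // (_ : (_ == _) = false) //.
    by apply: contraNF ne => /eqP[->].
  move: iI'; rewrite -{}e => iI'; have [gI _ _ _] := iI.
  pose m := maxn (size nu).+1 (size nu').+1.
  have d1 := deep_le (leq_maxl _ _ : (_ <= m)%N) (frakIA_deep iI).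
  have d2 := deep_le (leq_maxr _ _ : (_ <= m)%N) (frakIA_deep iI').
  rewrite (glift_cdot hmuG mu_fin gI d1 d2) h_cdot //; congr (_%:R); congr nat_of_bool.
  by apply/eqP/eqP => [[-> ->]|[-> ->]].
Qed.

(** The lift is linear, so the finite expansion of a cylinder indicator on the path space carries
    over term by term. *)
Lemma basis_closed_span_Zpart gam (w : word N) : IA A gam -> prefix gam.2 w ->
  closed_span muG (basis_fun mu h @` basis_domain A J) (\1_(Zpart gam w) : G -> R[i]).
Proof.
move=> gI /prefixP[s ->]; have [_ Ab b0 _ _] := gI.
have SL : (basis_fun mu h @` basis_domain A J) `<=` L2 muG.
  by move=> _ [i iI <-]; exact: basis_fun_L2.
apply: span_closed_span => //; rewrite -glift_indic.
have [n [c [e [Se fe]]]] := cyl_in_span hlmax1 huv hmu hh s Ab b0.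
exists n, c, (fun i => glift gam (e i)); split=> [i|g].
  have [->|[k [nu [j [k0 kI ->]]]]] := Se i; first by exists (inl gam).
  by exists (inr (gam, nu, j)) => //; case: kI => p1 p2 _ p3; split.
rewrite /glift fe mulr_sumr; apply: eq_bigr => i _; exact: mulrCA.
Qed.

Lemma basis_L2_closed_span :
  L2 muG `<=` closed_span muG (basis_fun mu h @` basis_domain A J).
Proof.
apply: (groupoid_L2_closed_span hmuG mu_fin).
  by move=> _ [i iI <-]; exact: basis_fun_L2.
exact: basis_closed_span_Zpart.
Qed.

(** The function is constant on every part and the kernel vanishes between parts, so the integrand
    is identically 0; only M_ell contributes to the eigenvalue of D. *)
Lemma Laplacian0_inl gam g : IA A gam ->
  Laplacian0 muG lam lmax (basis_fun mu h (inl gam)) g =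
  0 * basis_fun mu h (inl gam) g.
Proof.
move=> gI; rewrite mul0r /Laplacian0 -[RHS](cintegral0 muG) basis_fun_inl.
apply: eq_cintegral => g2.
have gg := Gpart_ell g.
have [g2g|ng2] := pselect (Gpart (ell_r g, ell_s g) g2); last first.
  by rewrite (kernel_neq _ _ gg ng2) mulr0.
suff -> : glift gam (hnorm mu gam.2) g = glift gam (hnorm mu gam.2) g2 :> R[i].
  by rewrite subrr mul0r.
have [h1|h1] := pselect (Gpart gam g).
  have h2 : Gpart gam g2 by rewrite (Gpart_disj h1 gg).
  rewrite !gliftE // /hnorm !indicE !mem_set //; exact: Gpart_src.
rewrite !glift0 // => h2; apply: h1.
by rewrite (Gpart_disj h2 g2g).
Qed.

Lemma Laplacian0_inr gam nu j g : frakIA A J (gam, nu, j) ->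
  Laplacian0 muG lam lmax (basis_fun mu h (inr (gam, nu, j))) g =
  (lambdaA A lmax u v gam.2 nu)%:C * basis_fun mu h (inr (gam, nu, j)) g.
Proof.
move=> tI; have dh := frakIA_deep tI; have [/= gI Anu pnu jJ] := tI.
have [_ Ab b0 _ _] := gI; have kI := frakIA_level Anu pnu jJ.
apply: (Laplacian0_glift hlam hlmax1 huv hmu hmuG gI pnu dh).
  exact (h_support hh Ab b0 (ltn0Sn _) kI).
exact (h_cintegral hh Ab b0 (ltn0Sn _) kI).
Qed.

End GroupoidBasis.

Unset Implicit Arguments.
Set Strict Implicit.

Theorem theorem1 (R : realType) (N : nat) (A : 'M[bool]_N.+1)
    (hA : primitive A)
    (lam : R) (hlam : 1 < lam)
    (lmax : R) (hlmax : PF_eigenvalue A lmax) (hlmax1 : 1 < lmax)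
    (u v : 'cV[R]_N.+1) (huv : PF_eigenvectors A lmax u v)
    (mu : {measure set (borel (path_space hA)) -> \bar R})
    (hmu : parry_measure lmax u v mu)
    (muG : {measure set (borel (groupoid hA)) -> \bar R})
    (hmuG : groupoid_measure mu muG)
    (J : word N -> word N -> {set 'I_N.+1})
    (h : word N -> word N -> 'I_N.+1 -> path_space hA -> R[i])
    (hh : level_basis mu J h) :
  [/\ forall i, basis_domain A J i ->
        @Ccinfty R (groupoid hA) (basis_fun mu h i),
      orthonormal_basis muG (basis_domain A J) (basis_fun mu h),
      forall gam, IA A gam ->
        Dirac muG lam lmax (basis_fun mu h (inl gam))
          (fun g => sgn_gam gam * (gam_size gam)%:R * basis_fun mu h (inl gam) g),
      forall gam nu j, frakIA A J (gam, nu, j) ->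
        Dirac muG lam lmax (basis_fun mu h (inr (gam, nu, j)))
          (fun g => - ((gam_size gam)%:R + (lambdaA A lmax u v gam.2 nu)%:C) *
                    basis_fun mu h (inr (gam, nu, j)) g) &
      forall gam nu j, frakIA A J (gam, nu, j) ->
        op_eigenvalue muG (Laplacian muG lam lmax)
          (lambdaA A lmax u v gam.2 nu)%:C].
Proof.
have mu_fin := parry_fin hmu.
have dom gam nu j : frakIA A J (gam, nu, j) ->
    basis_domain A J (inr (gam, nu, j)) by [].
split.
- move=> i /(basis_fun_deep hh) [gam [n [phi [gI dphi ->]]]].
  exact (glift_Ccinfty gI dphi).
- split; first exact (basis_fun_L2 hmu hmuG hh).
    exact (basis_fun_orthonormal hlmax1 huv hmu hmuG hh).
  exact (basis_L2_closed_span hlmax1 huv hmu hmuG hh).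
- move=> gam gI; have [_ _ b0 _ _] := gI.
  have dphi := hnorm_deep mu gam.2.
  have Lf g : Laplacian0 muG lam lmax (glift gam (hnorm mu gam.2)) g =
      0 * glift gam (hnorm mu gam.2) g := Laplacian0_inl lam lmax mu muG h g gI.
  rewrite /sgn_gam; case: eqP => s1.
    have FAf : FA muG (glift gam (hnorm mu gam.2)).
      set c := ((Num.sqrt (fine (mu (cyl gam.2))))^-1)%:C : R[i].
      have -> : glift gam (hnorm mu gam.2) = (fun g => c * \1_(Gpart gam) g).
        apply/funext => g; have [gg|gg] := pselect (Gpart gam g).
          by rewrite gliftE // /hnorm !indicE !mem_set //; exact: Gpart_src.
        by rewrite glift0 // indicE memNset // mulr0.
      apply: (closed_spanZ (FA_gens_L2 hmuG mu_fin)).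
      apply: (span_closed_span (FA_gens_L2 hmuG mu_fin)); apply: span_id.
      by exists gam.
    have := Dirac_pos hmuG mu_fin gI dphi Lf FAf.
    by under eq_fun do rewrite add0r; rewrite mul1r.
  (* A part whose source word has length different from 1 is disjoint from all the parts generating
     F_A. *)
  have := Dirac_neg hmuG mu_fin gI dphi Lf.
  rewrite addr0 mulN1r; apply=> gam' gI' s1'.
  have [_ _ b0' _ _] := gI'.
  rewrite -(Zpart_Gpart hA b0') -glift_indic; apply: glift_cdot_neq.
  by apply/eqP => e; apply: s1; rewrite e.
- move=> gam nu j tI.
  have [[gI _ _ _] dphi] := (tI, frakIA_deep hh tI).
  apply: (Dirac_neg hmuG mu_fin gI dphi).
    by move=> g; exact: (Laplacian0_inr hlam hlmax1 huv hmu hmuG hh g tI).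
  move=> gam' gI' s1'; have [_ _ b0' _ _] := gI'.
  rewrite -(Zpart_Gpart hA b0') -glift_indic.
  (* On the same part the supports overlap, and orthogonality comes from [h] having level at least
     1. *)
  have [e|ne] := eqVneq gam gam'; last exact: glift_cdot_neq.
  rewrite -{gam' gI' s1' b0'}e; have [_ Anu pnu jJ] := tI; have [_ Ab b0 _ _] := gI.
  have db : @deep R N A hA gam.2 (size nu).+1 \1_(cyl gam.2).
    apply: deep_le (deep_indic (prefix_refl gam.2)).
    exact: leq_trans (size_prefix pnu) (leqnSn _).
  rewrite (glift_cdot hmuG mu_fin gI dphi db).
  exact (h_cdot_indic hh Ab b0 (ltn0Sn _) (frakIA_level Anu pnu jJ)).
- move=> gam nu j tI; exists (basis_fun mu h (inr (gam, nu, j))).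
  have f2 := basis_fun_L2 hmu hmuG hh (dom _ _ _ tI).
  have [[gI _ _ _] dphi] := (tI, frakIA_deep hh tI).
  split => //.
    (* If the function vanished almost everywhere, its squared norm 1 would be 0. *)
    move=> f0; have := basis_fun_orthonormal hlmax1 huv hmu hmuG hh
      (dom _ _ _ tI) (dom _ _ _ tI).
    by rewrite (cdot_ae0 f2 f2 f0) eqxx => /esym/eqP; rewrite oner_eq0.
  apply: (Laplacian_eigen hmuG mu_fin gI dphi) => g.
  exact: (Laplacian0_inr hlam hlmax1 huv hmu hmuG hh g tI).
Qed.
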